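(* Let $G$ be a finite simple subcubic graph that contains no cycle of length $4$. For $j\in\{0,1,2,3\}$ let $n_j(G)$ denote the number of vertices of degree $j$ in $G$. Then $$14\, i(G) \le 14 n_0(G) + 9 n_1(G) + 6 n_2(G) + 5 n_3(G).$$
   Context: A graph is subcubic if every vertex has degree at most $3$. A dominating set of $G$ is a set $S\subseteq V(G)$ such that every vertex not in $S$ has a neighbor in $S$; the independent domination number $i(G)$ is the minimum size of a dominating set of $G$ that is also an independent set. ''Contains no cycle of length $4$'' means no $4$-cycle as a subgraph. *)

(* Defs.v *)
From mathcomp Require Import all_boot.

Set Implicit Arguments.
Unset Strict Implicit.
Unset Printing Implicit Defensive.

(* A finite simple graph is a symmetric irreflexive adjacency
   relation [e : rel V] on a finite type [V] of vertices. *)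

Definition nbhd (V : finType) (e : rel V) (x : V) : {set V} := [set y | e x y].

Definition deg (V : finType) (e : rel V) (x : V) : nat := #|nbhd e x|.

Definition num_deg (V : finType) (e : rel V) (j : nat) : nat :=
  #|[set x | deg e x == j]|.

Definition subcubic (V : finType) (e : rel V) : Prop :=
  forall x : V, deg e x <= 3.

(* [ucycle e c] says that the vertices listed in [c] are pairwise distinct and
   cyclically adjacent; for [k >= 3] this is a (not necessarily induced)
   subgraph isomorphic to the cycle of length [k]. *)
Definition has_cycle (V : finType) (e : rel V) (k : nat) : Prop :=
  exists2 c : seq V, size c = k & ucycle e c.

Definition independent (V : finType) (e : rel V) (S : {set V}) : bool :=
  [forall x in S, forall y in S, ~~ e x y].

Definition dominating (V : finType) (e : rel V) (S : {set V}) : bool :=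
  [forall (x | x \notin S), exists y in S, e x y].

Definition indep_dom (V : finType) (e : rel V) (S : {set V}) : bool :=
  independent e S && dominating e S.

(* The default value [#|V|] bounds the size of every vertex set, so it does not
   affect the minimum over a nonempty family; see [indep_dom_num_ex] and
   [indep_dom_num_min]. *)
Definition indep_dom_num (V : finType) (e : rel V) : nat :=
  \big[minn/#|V|]_(S : {set V} | indep_dom e S) #|S|.

Lemma indep_dom_num_min (V : finType) (e : rel V) (S : {set V}) :
  indep_dom e S -> indep_dom_num e <= #|S|.
Proof.
move=> idS; rewrite /indep_dom_num.
elim: (index_enum _) (mem_index_enum S) => // A s IHs.
rewrite inE big_cons => /predU1P[<- | /IHs le_s]; first by rewrite idS geq_minl.
by case: ifP => // _; rewrite geq_min le_s orbT.
Qed.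

Lemma indep_dom_exists (V : finType) (e : rel V) :
  symmetric e -> irreflexive e -> exists S : {set V}, indep_dom e S.
Proof.
move=> esym eirr.
have ind0 : independent e set0.
  by apply/forall_inP => x; rewrite inE.
have [S /maxsetP[indS maxS] _] := maxset_exists ind0.
exists S; rewrite /indep_dom indS /=; apply/forall_inP => x xNS.
apply: contraT => /exists_inPn noadj.
have indxS : independent e (x |: S).
  apply/forall_inP => y /setU1P[-> | yS]; apply/forall_inP => z /setU1P[-> | zS].
  - by rewrite eirr.
  - exact: noadj.
  - by rewrite esym; apply: noadj.
  - by move/forall_inP: indS => /(_ y yS) /forall_inP /(_ z zS).
by move: xNS; rewrite -(maxS _ indxS (subsetUr _ _)) setU11.
Qed.

Lemma indep_dom_num_ex (V : finType) (e : rel V) :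
  symmetric e -> irreflexive e ->
  exists2 S : {set V}, indep_dom e S & #|S| = indep_dom_num e.
Proof.
move=> esym eirr; have [S0 idS0] := indep_dom_exists esym eirr.
case: (arg_minnP (fun S : {set V} => #|S|) idS0) => S idS minS.
exists S => //; apply/eqP; rewrite eqn_leq indep_dom_num_min // andbT.
rewrite /indep_dom_num; elim/big_ind: _ => [|a b le_a le_b|A /minS //].
  exact: max_card.
by rewrite leq_min le_a.
Qed.

(* Main.v *)
Require Import Defs.
From mathcomp Require Import all_boot.
From mathcomp Require Import zify.

Set Implicit Arguments.
Unset Strict Implicit.
Unset Printing Implicit Defensive.

(** The bound is the total weight [sum (5 + (3 - deg x)^2)].  If [I] is a nonempty
    independent set and deleting its closed neighbourhood lowers the total weight by
    at least [14 |I|], then an independent dominating set of the rest extends by [I],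
    so a minimal counterexample has no such [I].

    Call a vertex of degree 3 good if it has a leaf neighbour or exactly two
    neighbours of degree 2.  In a minimal counterexample the neighbours of degree 3
    of a good vertex are good, and so are the ends of a thread (two adjacent
    vertices of degree 2).  Hence leaves, good vertices and the neighbours of degree
    2 of good vertices form a union of components, and there the leaves, one vertex
    of each thread and the remaining vertices of degree 2 form an independent set
    [I] that can be deleted.  So there are neither leaves nor threads; then every
    vertex of degree 3 has exactly one neighbour of degree 2, there are no
    triangles, and after excluding three kinds of short cycles a set [I] of at most
    four vertices always works.

    The local steps are finite case analyses on a neighbourhood that is revealed
    vertex by vertex.  They were found by computer search and are replayed by a
    verified checker. *)

(** * Deletion of closed neighbourhoods *)

(** Takes the values 14, 9, 6, 5 at [d] = 0, 1, 2, 3, the coefficients of the theorem. The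
    successive edges lost by a vertex of degree 3 cost 1, 3 and 5. *)
Definition weight (d : nat) : nat := 5 + (3 - d) ^ 2.

Definition total_weight (V : finType) (e : rel V) : nat :=
  \sum_x weight (deg e x).

Definition closed_nbhd (V : finType) (e : rel V) (I : {set V}) : {set V} :=
  [set y | (y \in I) || [exists x in I, e x y]].

(** Two distinct vertices have at most one common neighbour: the form in which the exclusion of
    4-cycles is applied. *)
Definition c4_free (V : finType) (e : rel V) : Prop :=
  forall a b x y : V, e a x -> e x b -> e a y -> e y b -> a != b -> x = y.

(** The sum is the total weight of the graph left after the deletion ([remnant_weight]), written
    with the degrees of [e]. *)
Definition deletable (V : finType) (e : rel V) (I : {set V}) : bool :=
  14 * #|I| + \sum_(y | y \notin closed_nbhd e I)
     weight (deg e y - #|nbhd e y :&: closed_nbhd e I|) <= total_weight e.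

Section Deletion.
Variables (V : finType) (e : rel V).
Hypotheses (e_sym : symmetric e) (e_irr : irreflexive e).

Lemma total_weightE : subcubic e ->
  total_weight e =
    14 * num_deg e 0 + 9 * num_deg e 1 + 6 * num_deg e 2 + 5 * num_deg e 3.
Proof.
move=> e3; have num_degE j : num_deg e j = \sum_x (deg e x == j).
  by rewrite /num_deg -sum1dep_card [LHS]big_mkcond; apply: eq_bigr => x _; case: eqP.
rewrite !num_degE !big_distrr -!big_split; apply: eq_bigr => x _ /=.
by case: (deg e x) (e3 x) => [|[|[|[|]]]].
Qed.

Lemma c4_freeP : ~ has_cycle e 4 -> c4_free e.
Proof.
move=> noC4 a b x y ax xb ay yb ab; apply/eqP/negPn/negP => xy; apply: noC4.
have neq u v : e u v -> u != v by apply: contraTneq => ->; rewrite e_irr.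
exists [:: a; x; b; y] => //.
rewrite /ucycle /= !inE ax xb (e_sym b y) yb (e_sym y a) ay !negb_or ab.
by rewrite (neq _ _ ax) (neq _ _ ay) xy (eq_sym b) (neq _ _ yb) (neq _ _ xb).
Qed.

Variable I : {set V}.
Let C := closed_nbhd e I.
Definition remnant : finType := {x : V | x \notin C}.
Definition remnant_rel : rel remnant := relpre val e.

Lemma remnant_deg (x : remnant) :
  deg remnant_rel x = deg e (val x) - #|nbhd e (val x) :&: C|.
Proof.
rewrite /deg -cardsD -(card_imset _ val_inj); apply: eq_card => y.
apply/imsetP/setDP => [[z]|[ye yC]].
  by rewrite inE => xz ->; split; [rewrite inE | exact: (valP z)].
by exists (Sub y yC); rewrite ?SubK //; move: ye; rewrite !inE.
Qed.

Lemma remnant_weight :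
  total_weight remnant_rel =
  \sum_(y | y \notin C) weight (deg e y - #|nbhd e y :&: C|).
Proof.
rewrite /total_weight (reindex_omap (val : remnant -> V) insub); last first.
  by move=> y yC; rewrite insubT.
apply: eq_big => [x|x _]; last by rewrite remnant_deg.
by rewrite valK eqxx (valP x).
Qed.

(** An optimal set [S] of the remnant can be joined to [I]: no vertex of the remnant is adjacent to
    [I], and [I] dominates everything deleted. *)
Lemma indep_dom_num_deletion :
  independent e I -> indep_dom_num e <= #|I| + indep_dom_num remnant_rel.
Proof.
move=> /forall_inP indI.
have sym' : symmetric remnant_rel by move=> x y; apply: e_sym.
have irr' : irreflexive remnant_rel by move=> x; apply: e_irr.
have [S /andP[/forall_inP indS /forall_inP domS] <-] := indep_dom_num_ex sym' irr'.
rewrite -(card_imset _ val_inj).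
apply: leq_trans (_ : #|I :|: val @: S| <= _); last by rewrite cardsU leq_subr.
have farS x y : x \in I -> y \in S -> ~~ e x (val y).
  move=> xI yS; apply: contra (valP y) => xy; rewrite inE.
  by apply/orP; right; apply/exists_inP; exists x.
apply: indep_dom_num_min; apply/andP; split.
  apply/forall_inP => x /setUP[xI|/imsetP[x' xS ->]];
    apply/forall_inP => y /setUP[yI|/imsetP[y' yS ->]].
  - by move/forall_inP: (indI x xI); apply.
  - exact: farS.
  - by rewrite e_sym farS.
  - by move/forall_inP: (indS x' xS); apply.
apply/forall_inP => x; rewrite inE negb_or => /andP[xI xS].
have [xC|xC] := boolP (x \in C).
  move: xC; rewrite inE (negPf xI) /= => /exists_inP[y yI yx].
  by apply/exists_inP; exists y; rewrite ?inE ?yI // e_sym.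
have x'S : (Sub x xC : remnant) \notin S.
  by apply: contra xS => x'S; apply/imsetP; exists (Sub x xC).
have /exists_inP[y yS xy] := domS _ x'S.
by apply/exists_inP; exists (val y) => //; rewrite inE imset_f ?orbT.
Qed.

End Deletion.

Definition sparse (V : finType) (e : rel V) : Prop :=
  [/\ symmetric e, irreflexive e, subcubic e & c4_free e].

Lemma remnant_sparse (V : finType) (e : rel V) (I : {set V}) :
  sparse e -> sparse (remnant_rel (e := e) (I := I)).
Proof.
move=> [e_sym e_irr e3 e4]; split=> [x y|x|x|a b x y ax xb ay yb ab].
- exact: e_sym.
- exact: e_irr.
- by rewrite remnant_deg; apply: leq_trans (leq_subr _ _) (e3 _).
- by apply: val_inj; apply: (e4 (val a) (val b)).
Qed.

(** Strong induction on the number of vertices: [I] is nonempty, so the remnant is smaller, and it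
    is again sparse. *)
Lemma indep_dom_num_weight :
  (forall (V : finType) (e : rel V), sparse e -> 0 < #|V| ->
     exists I : {set V}, [/\ independent e I, I != set0 & deletable e I]) ->
  forall (V : finType) (e : rel V), sparse e ->
    14 * indep_dom_num e <= total_weight e.
Proof.
move=> red V; have [n] := ubnP #|V|; elim: n V => // n IHn V le_Vn e He.
have [e_sym e_irr _ _] := He.
have [V0|V_gt0] := posnP #|V|.
  have [S _ <-] := indep_dom_num_ex e_sym e_irr.
  by have := max_card S; rewrite V0 leqn0 => /eqP->.
have [I [indI I0 delI]] := red V e He V_gt0.
apply: leq_trans delI.
apply: leq_trans (_ : 14 * (#|I| + indep_dom_num (remnant_rel (e := e) (I := I))) <= _).
  by rewrite leq_mul2l /= indep_dom_num_deletion.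
rewrite mulnDr leq_add2l -remnant_weight; apply: IHn; last exact: remnant_sparse.
rewrite -ltnS; apply: leq_trans le_Vn; rewrite ltnS card_sig.
have [x xI] := set0Pn _ I0.
rewrite -[ltnRHS](cardC (mem (~: closed_nbhd e I))).
rewrite -addn1; apply: leq_add; first by apply: subset_leq_card; apply/subsetP => y; rewrite !inE.
by apply/card_gt0P; exists x; rewrite !inE xI.
Qed.

(** * Partially revealed graphs and refutation certificates *)

(* Vertices are labels [0, 1, ...]; [c.1] lists their degrees in the whole graph and [c.2] the
   edges revealed so far. *)
Definition config : Type := (seq nat * seq (nat * nat))%type.

Implicit Types (c : config) (i j : nat).

Definition lab_deg c i : nat := nth 0 c.1 i.

Definition adj c i : seq nat :=
  undup (flatten [seq (if p.1 == i then [:: p.2] else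
                       if p.2 == i then [:: p.1] else [::]) | p <- c.2]).

(* All edges at [i] are revealed. *)
Definition full c i : bool := size (adj c i) == lab_deg c i.

Definition extend c v (js ds : seq nat) : config :=
  (c.1 ++ ds, c.2 ++ [seq (v, j) | j <- js ++ iota (size c.1) (size ds)]).

Fixpoint combs (k : nat) (s : seq nat) : seq (seq nat) :=
  match k, s with
  | 0, _ => [:: [::]]
  | _.+1, [::] => [::]
  | k'.+1, x :: s' => [seq x :: t | t <- combs k' s'] ++ combs k s'
  end.

(** New neighbours are interchangeable, so only the multiset of their degrees matters; each multiset
    is listed once, in increasing order. A neighbour never has degree 0. *)
Definition degree_lists (m : nat) : seq (seq nat) :=
  [seq nseq a 1 ++ nseq b 2 ++ nseq (m - a - b) 3 |
     a <- iota 0 m.+1, b <- iota 0 (m - a).+1].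

(** Of the [m] missing neighbours of [v], [k] already carry labels and the others are new. An old
    label qualifies only if it still has an unrevealed edge. *)
Definition children c v : seq config :=
  let m := lab_deg c v - size (adj c v) in
  let cand := [seq j <- iota 0 (size c.1) |
     [&& j != v, j \notin adj c v & size (adj c j) < lab_deg c j]] in
  flatten [seq [seq extend c v js ds | js <- combs k cand, ds <- degree_lists (m - k)] |
             k <- iota 0 m.+1].

(* An edge not yet revealed costs at most 5, the largest weight increase caused by lowering a
   degree by one. *)
Definition reducible c (I : seq nat) : bool :=
  let X := undup (flatten [seq i :: adj c i | i <- I]) in
  let loss y := weight (lab_deg c y - count (fun x => y \in adj c x) X) - weight (lab_deg c y) in
  [&& 0 < size I, all (fun i => (i < size c.1) && full c i) I,
      all (fun i => all (fun j => j \notin adj c i) I) I &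
      14 * size I + sumn [seq loss y | y <- iota 0 (size c.1) & y \notin X]
        + 5 * sumn [seq lab_deg c x - size (adj c x) | x <- X]
      <= sumn [seq weight (lab_deg c x) | x <- X]].

(* A certificate is the preorder listing of a case tree: [Reveal v] branches on the unknown
   neighbours of [v], [Delete s] closes a branch by deleting the closed neighbourhood of [s]. *)
Inductive step := Reveal of nat | Delete of seq nat.

(** [cs] is the stack of open branches. Children that violate [ok] are dropped, so a [Reveal] all of
    whose children fail closes its branch by itself. *)
Fixpoint refutes (ok : pred config) (ts : seq step) (cs : seq config) : bool :=
  match ts, cs with
  | [::], [::] => true
  | Delete s :: ts', c :: cs' => reducible c s && refutes ok ts' cs'
  | Reveal v :: ts', c :: cs' =>
      (v < size c.1) && refutes ok ts' ([seq c' <- children c v | ok c'] ++ cs')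
  | _, _ => false
  end.

Lemma mem_combs (t s : seq nat) : subseq t s -> t \in combs (size t) s.
Proof.
elim: s t => [|x s IHs] [|y t] //=; do ?by rewrite inE.
rewrite mem_cat; case: eqP => [->|_] /IHs h; last by rewrite h orbT.
by apply/orP; left; apply/mapP; exists t.
Qed.

Lemma mem_degree_lists (a b d : nat) :
  nseq a 1 ++ nseq b 2 ++ nseq d 3 \in degree_lists (a + b + d).
Proof.
apply/allpairsPdep; exists a, b; split; rewrite ?mem_iota ?inE; try lia.
by congr (_ ++ (_ ++ nseq _ _)); lia.
Qed.

Lemma mem_adj c i j : (j \in adj c i) = ((i, j) \in c.2) || ((j, i) \in c.2).
Proof.
rewrite mem_undup; apply/flatten_mapP/orP => [[[p q] pq] /=|[] ij].
- by case: eqP => [<-|_]; last case: eqP => // <-; rewrite inE => /eqP->; [left|right].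
- by exists (i, j); rewrite //= eqxx inE.
- by exists (j, i); rewrite //= eqxx; case: eqP => [->|_]; rewrite inE.
Qed.

Lemma adj_sym c i j : (j \in adj c i) = (i \in adj c j).
Proof. by rewrite !mem_adj orbC. Qed.

(** * Configurations realised in a graph *)

Section Embedding.
Variables (V : finType) (e : rel V).
Hypothesis He : sparse e.

(** Pairs outside [c.2] are left open; the absence of an edge is inferred only at full labels,
    through [fullP]. *)
Definition embeds (f : nat -> V) c : Prop :=
  [/\ {in gtn (size c.1) &, injective f},
      forall i, i < size c.1 -> deg e (f i) = lab_deg c i
    & forall i j, (i, j) \in c.2 -> [/\ i < size c.1, j < size c.1 & e (f i) (f j)]].

Lemma embeds_seq (s : seq V) c (x0 : V) :
  uniq s -> [seq deg e x | x <- s] = c.1 ->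
  all (fun p => [&& p.1 < size s, p.2 < size s & e (nth x0 s p.1) (nth x0 s p.2)]) c.2 ->
  embeds (nth x0 s) c.
Proof.
move=> us ds es; rewrite /embeds /lab_deg -ds size_map; split.
- by move=> i j; rewrite !inE => ? ? /eqP; rewrite nth_uniq // => /eqP.
- by move=> i lt_is; rewrite (nth_map x0).
- by move=> i j /(allP es) /and3P.
Qed.

Variables (f : nat -> V) (c : config).
Hypothesis fc : embeds f c.
Let n := size c.1.

Lemma embeds_adj i j : j \in adj c i -> [/\ i < n, j < n & e (f i) (f j)].
Proof.
case: fc He => _ _ h [e_sym _ _ _].
by rewrite mem_adj => /orP[] /h[? ? ?]; split=> //; rewrite e_sym.
Qed.

Lemma embeds_uniq (s : seq nat) : uniq s -> {subset s <= gtn n} -> uniq (map f s).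
Proof.
by case: fc => inj _ _ us sn; rewrite map_inj_in_uniq // => i j /sn ? /sn ?; apply: inj.
Qed.

Lemma embeds_mem i (s : seq nat) :
  i < n -> {subset s <= gtn n} -> (f i \in map f s) = (i \in s).
Proof.
case: fc => inj _ _ lt_in sn; apply/mapP/idP => [[j js /inj->] //|is_]; last by exists i.
exact: sn.
Qed.

Lemma adj_lt i : {subset adj c i <= gtn n}.
Proof. by move=> j /embeds_adj[]. Qed.

Lemma size_adj i : i < n -> size (adj c i) <= lab_deg c i.
Proof.
case: fc => _ degf _ lt_in; rewrite -degf // -(size_map f) -(card_uniqP _).
  by apply: subset_leq_card; apply/subsetP => _ /mapP[j /embeds_adj[_ _ ?] ->]; rewrite inE.
by apply: embeds_uniq; [apply: undup_uniq | apply: adj_lt].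
Qed.

(** The revealed neighbours are distinct and as many as the degree, so they exhaust the
    neighbourhood. *)
Lemma fullP i w : i < n -> full c i -> e (f i) w -> exists2 j, j \in adj c i & w = f j.
Proof.
case: fc => _ degf _ lt_in /eqP fi iw.
have sub : [set x in map f (adj c i)] \subset nbhd e (f i).
  by apply/subsetP => x; rewrite inE => /mapP[j /embeds_adj[_ _ ?] ->]; rewrite inE.
have card_im : #|[set x in map f (adj c i)]| = deg e (f i).
  rewrite cardsE (card_uniqP _) ?size_map ?fi ?degf //.
  by apply: embeds_uniq; [apply: undup_uniq | apply: adj_lt].
have /eqP nE : [set x in map f (adj c i)] == nbhd e (f i) by rewrite eqEcard sub card_im /=.
have : w \in nbhd e (f i) by rewrite inE.
by rewrite -nE inE => /mapP[j]; exists j.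
Qed.

Lemma closed_nbhd_embeds (s : seq nat) :
  all (fun i => (i < n) && full c i) s ->
  closed_nbhd e [set x in map f s] =
  [set x in map f (undup (flatten [seq i :: adj c i | i <- s]))].
Proof.
move=> /allP fs; apply/setP => y; rewrite !inE; apply/orP/mapP => [[/mapP[i is_ ->]|]|[j]].
- by exists i => //; rewrite mem_undup; apply/flatten_mapP; exists i; rewrite ?mem_head.
- case/exists_inP => x; rewrite inE => /mapP[i is_ ->] iy; have /andP[ni fi] := fs _ is_.
  have [j ji ->] := fullP ni fi iy; exists j => //; rewrite mem_undup.
  by apply/flatten_mapP; exists i; rewrite // inE ji orbT.
rewrite mem_undup => /flatten_mapP[i is_]; rewrite inE => /predU1P[->|ij] ->.
  by left; rewrite map_f.
right; apply/exists_inP; exists (f i); first by rewrite inE map_f.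
by have [] := embeds_adj ij.
Qed.

(** The [k] revealed edges are charged their exact cost; each of the [m] others costs at most 5. *)
Lemma weight_drop d k m : d <= 3 ->
  weight (d - (k + m)) <= weight d + (weight (d - k) - weight d) + 5 * m.
Proof.
case: d => [|[|[|[|//]]]] _; case: k => [|[|[|[|k]]]]; case: m => [|[|[|[|m]]]] //;
  rewrite /weight ?addSn ?subSS ?sub0n /=; lia.
Qed.

(** The labels in [s] are full, so the deleted set [C] is exactly the image of [X]. The edges from
    an outer vertex [y] into [C] split into [k y] revealed ones, charged exactly by [loss], and
    [m y] unrevealed ones, charged 5 each. *)
Lemma reducible_deletable (s : seq nat) : reducible c s ->
  exists I : {set V}, [/\ independent e I, I != set0 & deletable e I].
Proof.
case/and4P; set X := undup _; set loss := (fun y => _ - _) => s0 fs ind le_w.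
have [inj degf edge] := fc; have [e_sym e_irr e3 _] := He.
exists [set x in map f s]; split.
- apply/forall_inP => _ /[!inE] /mapP[i is_ ->]; apply/forall_inP => _ /[!inE] /mapP[j js ->].
  have /andP[ni fi] := allP fs _ is_; have /andP[nj _] := allP fs _ js.
  apply/negP => /(fullP ni fi)[k ki /inj]; rewrite !inE => /(_ nj (adj_lt ki)) jk.
  by have := allP (allP ind _ is_) _ js; rewrite jk ki.
- case: s s0 {fs ind le_w X loss} => // i s _; apply/set0Pn; exists (f i).
  by rewrite inE mem_head.
rewrite /deletable (closed_nbhd_embeds fs) -/X; set C := [set x in map f X].
have Xn : {subset X <= gtn n}.
  move=> j; rewrite mem_undup => /flatten_mapP[i is_]; rewrite inE => /predU1P[->|].
    by have /andP[] := allP fs _ is_.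
  exact: adj_lt.
have uX : uniq X by apply: undup_uniq.
have ufX : uniq (map f X) by apply: embeds_uniq.
pose k (y : V) := \sum_(x <- X) (y \in map f (adj c x)).
pose m (y : V) := \sum_(x <- X) (e (f x) y && (y \notin map f (adj c x))).
have eE y : #|nbhd e y :&: C| = k y + m y.
  rewrite -big_split /= -sum1_card (eq_bigl (fun x => (x \in map f X) && e y x)); last first.
    by move=> x; rewrite !inE andbC.
  rewrite big_mkcondr /= -big_uniq // big_map; apply: eq_bigr => x _.
  rewrite e_sym; case: (boolP (y \in _)) => [/mapP[j /embeds_adj[_ _ xj] ->]|_].
    by rewrite xj.
  by rewrite andbT; case: (e _ _).
have k0 y : y \notin map f (iota 0 n) -> k y = 0.
  move=> yn; rewrite /k big1_seq // => x _; apply/eqP; rewrite eqb0.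
  by apply: contra yn => /mapP[j /adj_lt jn ->]; rewrite map_f // mem_iota.
(* Vertices without a label have no revealed edge, so only labelled ones contribute. *)
have sum_loss : \sum_(y | y \notin C) (weight (deg e y - k y) - weight (deg e y)) <=
    sumn [seq loss y | y <- iota 0 n & y \notin X].
  set r := [seq y <- iota 0 n | y \notin X].
  have rn : {subset r <= gtn n} by move=> j; rewrite mem_filter mem_iota => /andP[].
  have ufr : uniq (map f r) by apply: embeds_uniq; rewrite ?filter_uniq ?iota_uniq.
  rewrite (bigID (mem (map f r))) /= [X in _ + X]big1 ?addn0 => [|y /andP[yC yr]]; last first.
    rewrite k0 ?subn0 ?subnn //; apply: contra yr => /mapP[j jn yj].
    rewrite yj map_f // mem_filter jn andbT.
    by apply: contra yC => jX; rewrite yj inE map_f.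
  apply: (@leq_trans (\sum_(y in map f r) (weight (deg e y - k y) - weight (deg e y)))).
    rewrite [leqRHS](bigID (fun y => y \notin C)) /=.
    by under eq_bigl do rewrite andbC; apply: leq_addr.
  rewrite -big_uniq // big_map sumnE big_map leq_eqVlt; apply/orP; left; apply/eqP.
  apply: eq_big_seq => j jr; have jn := rn _ jr; rewrite degf // /loss.
  congr (weight (_ - _) - _); rewrite -sum1_count /k [RHS]big_mkcond; apply: eq_bigr => x _ /=.
  by rewrite (embeds_mem _ (@adj_lt x)) //; case: (_ \in _).
(* Counted from the deleted side: the unrevealed edges at [x] number at most its missing degree. *)
have sum_m : \sum_(y | y \notin C) m y <= sumn [seq lab_deg c x - size (adj c x) | x <- X].
  rewrite exchange_big sumnE big_map /= big_seq [leqRHS]big_seq; apply: leq_sum => x xX.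
  have xn := Xn _ xX.
  apply: (@leq_trans #|nbhd e (f x) :\: [set y in map f (adj c x)]|).
    rewrite -sum1_card big_mkcond [leqRHS]big_mkcond; apply: leq_sum => y _.
    by rewrite !inE; do 2!case: (y \in _) => //=; case: (e _ _).
  rewrite cardsD -/(deg e (f x)) degf // leq_sub2l //.
  rewrite (setIidPr _); last first.
    by apply/subsetP => y /[!inE] /mapP[j /embeds_adj[_ _ ?] ->].
  rewrite cardsE (card_uniqP _) ?size_map //.
  by apply: embeds_uniq; [apply: undup_uniq | apply: adj_lt].
have sum_X : \sum_(y in C) weight (deg e y) = sumn [seq weight (lab_deg c x) | x <- X].
  rewrite sumnE big_map; under eq_bigl do rewrite inE.
  rewrite -big_uniq // big_map; apply: eq_big_seq => x /Xn xn.
  by rewrite degf.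
rewrite /total_weight [leqRHS](bigID (fun y => y \in C)) /= sum_X.
have : \sum_(y | y \notin C) weight (deg e y - #|nbhd e y :&: C|) <=
    \sum_(y | y \notin C) weight (deg e y) +
    \sum_(y | y \notin C) (weight (deg e y - k y) - weight (deg e y)) +
    5 * \sum_(y | y \notin C) m y.
  rewrite big_distrr -!big_split; apply: leq_sum => y _ /=.
  by rewrite eE; apply: weight_drop.
have : #|[set x in map f s]| <= size s.
  by rewrite cardsE; apply: leq_trans (card_size _) _; rewrite size_map.
move: le_w sum_loss sum_m; rewrite -/n => h1 h2 h3 h4 h5.
have arith (p q l1 l2 m1 m2 w u d : nat) : 14 * q + l2 + 5 * m2 <= w -> l1 <= l2 ->
    m1 <= m2 -> p <= q -> u <= d + l1 + 5 * m1 -> 14 * p + u <= w + d by lia.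
exact: arith h1 h2 h3 h4 h5.
Qed.

(** The branching is exhaustive: each missing neighbour of [f v] is either the image of an old
    label, collected in [js], or a new vertex, collected in [ws]. *)
Lemma embeds_children v : v < n ->
  exists2 c', c' \in children c v & exists f', embeds f' c'.
Proof.
move=> vn; have [inj degf edge] := fc; have [e_sym e_irr e3 _] := He.
set m := lab_deg c v - size (adj c v).
pose M := nbhd e (f v) :\: [set x in map f (adj c v)].
have cardM : #|M| = m.
  rewrite cardsD -/(deg e (f v)) degf // (setIidPr _); last first.
    by apply/subsetP => y /[!inE] /mapP[j /embeds_adj[_ _ ?] ->].
  rewrite cardsE (card_uniqP _) ?size_map //.
  by apply: embeds_uniq; [apply: undup_uniq | apply: adj_lt].
set cand := [seq j <- iota 0 n | [&& j != v, j \notin adj c v & size (adj c j) < lab_deg c j]].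
pose js := [seq j <- cand | f j \in M].
(* Such a [j] passes the filter of [cand]: if it were full, [fullP] would make its edge to [v] a
   revealed one. *)
have mem_js j : (j \in js) = (j < n) && (f j \in M).
  rewrite !mem_filter mem_iota add0n leq0n /= andbC.
  case jn: (j < n); rewrite ?andbF ?andbT //; apply/andP/idP => [[]//|jM]; split=> //.
  move: (jM); rewrite !inE => /andP[_ /andP[jv vj]].
  have jNv : j \notin adj c v by apply: contra jv => /(map_f f).
  apply/and3P; split=> //; first by apply: contraTneq vj => ->; rewrite e_irr.
  rewrite ltn_neqAle size_adj // andbT; apply: contra jNv => fj.
  have [|i ij /inj] := fullP jn fj (w := f v); first by rewrite e_sym.
  by rewrite !inE => -> //; [rewrite adj_sym | apply: adj_lt ij].
(* The new neighbours are grouped by degree to match the sorted lists of [degree_lists]. *)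
pose N d := [seq w <- enum M | (w \notin map f (iota 0 n)) && (deg e w == d)].
pose ws := N 1 ++ N 2 ++ N 3.
have mem_N w d : (w \in N d) = [&& w \notin map f (iota 0 n), deg e w == d & w \in M].
  by rewrite mem_filter mem_enum andbA.
have mem_ws w : (w \in ws) = (w \notin map f (iota 0 n)) && (w \in M).
  rewrite !mem_cat !mem_N; case: (w \notin _) => //=; case wM: (w \in M); rewrite ?andbF //.
  have : deg e w != 0.
    by rewrite -lt0n; apply/card_gt0P; exists (f v); move: wM; rewrite !inE e_sym => /andP[].
  by case: (deg e w) (e3 w) => [|[|[|[|]]]].
have uN d : uniq (N d) by rewrite filter_uniq ?enum_uniq.
have uws : uniq ws.
  rewrite !cat_uniq !uN /= andbT; apply/andP; split; apply/hasPn => w.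
    by rewrite mem_cat !mem_N; case: (deg e w) => [|[|[|[|]]]] //=; rewrite ?andbF.
  by rewrite !mem_N; case: (deg e w) => [|[|[|[|]]]] //=; rewrite ?andbF.
pose ds := [seq deg e w | w <- ws].
have degN d : [seq deg e w | w <- N d] = nseq (size (N d)) d.
  rewrite -(size_map (deg e)).
  by apply/all_pred1P/allP => x /mapP[w]; rewrite mem_N => /and3P[_ /eqP<- _] ->; apply/eqP.
have dsE : ds = nseq (size (N 1)) 1 ++ nseq (size (N 2)) 2 ++ nseq (size (N 3)) 3.
  by rewrite /ds !map_cat !degN.
have ujs : uniq js by rewrite !filter_uniq ?iota_uniq.
have szm : size js + size ws = m.
  rewrite -cardM -(size_map f) -size_cat -(card_uniqP _); last first.
    rewrite cat_uniq uws andbT embeds_uniq //=; last by move=> j; rewrite mem_js => /andP[].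
    apply/hasPn => w; rewrite mem_ws => /andP[wn _]; apply: contra wn => /mapP[j].
    by rewrite mem_js => /andP[jn _] ->; rewrite map_f // mem_iota.
  apply: eq_card => w; rewrite mem_cat mem_ws; apply/orP/idP => [[/mapP[j]|/andP[]//]|wM].
    by rewrite mem_js => /andP[_ ?] ->.
  case: (boolP (w \in map f (iota 0 n))) => [/mapP[j jn wj]|_]; last by right.
  by left; rewrite wj map_f // mem_js -wj wM andbT; rewrite mem_iota in jn.
exists (extend c v js ds).
  apply/flatten_mapP; exists (size js); first by rewrite mem_iota; lia.
  apply/allpairsP; exists (js, ds); split=> //=; first exact/mem_combs/filter_subseq.
  have <- : size (N 1) + size (N 2) + size (N 3) = m - size js.
    by rewrite -szm !size_cat; lia.
  by rewrite dsE mem_degree_lists.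
have sz_t : size (map f (iota 0 n) ++ ws) = n + size ws by rewrite size_cat size_map size_iota.
have nth_lt i : i < n -> nth (f v) (map f (iota 0 n) ++ ws) i = f i.
  by move=> ni; rewrite nth_cat size_map size_iota ni (nth_map 0) ?size_iota // nth_iota.
(* Old labels keep their vertices and the new labels run through [ws]; [f v] is only a default
   value. *)
exists (nth (f v) (map f (iota 0 n) ++ ws)); apply: embeds_seq.
- rewrite cat_uniq uws andbT embeds_uniq ?iota_uniq //=; last by move=> j; rewrite mem_iota.
  by apply/hasPn => w; rewrite mem_ws => /andP[].
- rewrite map_cat; congr (_ ++ _); rewrite -map_comp /=.
  rewrite -[RHS](mkseq_nth 0); apply/eq_in_map => j; rewrite mem_iota => /andP[_ jn].
  exact: degf.
- apply/allP => -[i j] /=; rewrite mem_cat => /orP[/edge[ni nj ij]|/mapP[k kj [-> ->]]].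
    by rewrite sz_t !nth_lt // ij; apply/and3P; split=> //; apply: ltn_addr.
  rewrite sz_t nth_lt // (ltn_addr _ vn) /=; move: kj; rewrite mem_cat => /orP[].
    by rewrite mem_js => /andP[kn]; rewrite nth_lt // !inE ltn_addr // => /andP[].
  rewrite mem_iota size_map => /andP[nk kn]; rewrite kn nth_cat size_map size_iota ltnNge nk /=.
  have : nth (f v) ws (k - n) \in ws by apply: mem_nth; rewrite -(ltn_add2l n) subnKC.
  by rewrite mem_ws !inE => /andP[_ /andP[]].
Qed.

End Embedding.

(** At each [Reveal] a realised configuration has a realised child, which survives the filter.
    Following it must end at a [Delete], against the hypothesis on [I]. *)
Lemma refutes_sound (V : finType) (e : rel V) (ok : pred config) :
  sparse e ->
  (forall I : {set V}, independent e I -> I != set0 -> ~ deletable e I) ->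
  (forall f c, embeds e f c -> ok c) ->
  forall ts cs, refutes ok ts cs -> forall c f, c \in cs -> ~ embeds e f c.
Proof.
move=> He irr ok_sound; elim=> [|[v|s] ts IHts] [|c cs] //= /andP[h /IHts refs] c' f.
- rewrite inE => /predU1P[->|c'cs]; last by apply: refs; rewrite mem_cat c'cs orbT.
  move=> fc; have [c2 c2v [f2 fc2]] := embeds_children He fc h.
  by case: (refs c2 f2 _ fc2); rewrite mem_cat mem_filter (ok_sound _ _ fc2) c2v.
- rewrite inE => /predU1P[-> fc|]; last exact: refs.
  by have [I [indI I0]] := reducible_deletable He fc h; apply: irr.
Qed.

(** * Certificates *)

Definition labels (c : config) : seq nat := iota 0 (size c.1).
(** Only revealed neighbours are counted: a lower bound for [ndeg], exact at full labels. *)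
Definition lab_count (c : config) (i d : nat) : nat := count (fun j => lab_deg c j == d) (adj c i).

(* The [uniq] condition says that [i] is on no 4-cycle. *)
Definition admissible (c : config) : bool :=
  all (fun i => (size (adj c i) <= lab_deg c i)
    && uniq [seq k <- flatten [seq adj c j | j <- adj c i] | k != i]) (labels c).

Definition lab_thread (c : config) (z : nat) : bool := (lab_deg c z == 2) && (0 < lab_count c z 2).

Definition rule_thread (c : config) : bool :=
  all (fun i => (lab_deg c i == 3) ==> (count (lab_thread c) (adj c i) <= 1)) (labels c).

(** [lab_good] and [lab_bad] hold only when the revealed part settles the matter: one leaf suffices
    to be good, while an exact count needs a full label. *)
Definition lab_good (c : config) (i : nat) : bool :=
  (lab_deg c i == 3) && ((0 < lab_count c i 1) || full c i && (lab_count c i 2 == 2)).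

Definition lab_bad (c : config) (i : nat) : bool :=
  [&& lab_deg c i == 3, full c i, lab_count c i 1 == 0 & lab_count c i 2 != 2].

(** The two implications reflect [good_nbr] and [thread_end]. *)
Definition rule_good (c : config) : bool :=
  all (fun i => [&& lab_good c i ==> ~~ has (lab_bad c) (adj c i) &
      [&& lab_deg c i == 3, full c i & has (lab_thread c) (adj c i)] ==> (lab_count c i 2 == 2)])
    (labels c).

(** Collects [deg23], [no_thread] and [deg3_ndeg2_le1]. *)
Definition rule_core (c : config) : bool :=
  all (fun i => (lab_deg c i == 2) && (lab_count c i 2 == 0)
    || (lab_deg c i == 3) && (lab_count c i 2 <= 1)) (labels c).

(** The contrapositive of [ndeg2_nbr]. *)
Definition rule_even (c : config) : bool :=
  all (fun i => [&& lab_deg c i == 3, full c i & lab_count c i 2 == 0] ==>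
    all (fun j => (lab_deg c j == 3) ==> (lab_count c j 2 == 0)) (adj c i)) (labels c).

Definition rule_one (c : config) : bool :=
  all (fun i => (lab_deg c i == 3) && full c i ==> (lab_count c i 2 == 1)) (labels c).

(* [s] is the reversed walk; [ds] are the degrees of the vertices still to be visited.  The [if]
   is not a conjunction because [vm_compute] would evaluate both sides of [&&]. *)
Fixpoint closes (c : config) (s : seq nat) (ds : seq nat) : bool :=
  match ds with
  | [::] => last 0 s \in adj c (head 0 s)
  | d :: ds' =>
      has (fun j => if (lab_deg c j == d) && (j \notin s) then closes c (j :: s) ds' else false)
        (adj c (head 0 s))
  end.

Definition has_pattern (c : config) (ds : seq nat) : bool :=
  has (fun i => if lab_deg c i == head 0 ds then closes c [:: i] (behead ds) else false) (labels c).

(** Facts obtained under one rule set justify the next one, which prunes the later certificates. *)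
Definition ok_thread (c : config) := admissible c && rule_thread c.
Definition ok_good (c : config) := admissible c && rule_good c.
Definition ok_core (c : config) := admissible c && rule_core c.
Definition ok_even (c : config) := ok_core c && rule_even c.
Definition ok_pattern (ps : seq (seq nat)) (c : config) :=
  [&& ok_core c, rule_one c & ~~ has (has_pattern c) ps].

(* Degree sequences of cycles, excluded in the order triangles, alpha, gamma, beta. *)
Definition alpha := [:: 2; 3; 3; 3; 3].
Definition beta := [:: 2; 3; 3; 3; 3; 3; 3].
Definition gamma := [:: 2; 3; 3; 2; 3; 3; 3].
Definition triangles := [:: [:: 3; 3; 3]; [:: 2; 3; 3]].

(** * Certificates for leaves, threads and good vertices *)

Lemma cert_leaf_leaf : refutes admissible
  [:: Delete [:: 0]]
  [:: ([:: 1; 1], [:: (0, 1)])].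
Proof. by vm_compute. Qed.

Lemma cert_leaf_2 : refutes admissible
  [:: Reveal 1; Delete [:: 0]; Delete [:: 1]; Delete [:: 1]]
  [:: ([:: 1; 2], [:: (0, 1)])].
Proof. by vm_compute. Qed.

Lemma cert_3_leaf_leaf : refutes admissible
  [:: Reveal 0; Delete [:: 0]; Delete [:: 0]; Delete [:: 0]]
  [:: ([:: 3; 1; 1], [:: (0, 1); (0, 2)])].
Proof. by vm_compute. Qed.

Lemma cert_3_leaf_2 : refutes admissible
  [:: Reveal 0; Reveal 2; Delete [:: 0]; Reveal 3; Delete [:: 0]; Delete [:: 0]; Delete [:: 0];
      Delete [:: 0]; Delete [:: 0]; Delete [:: 3]; Delete [:: 2]; Delete [:: 0]; Delete [:: 0];
      Delete [:: 0]]
  [:: ([:: 3; 1; 2], [:: (0, 1); (0, 2)])].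
Proof. by vm_compute. Qed.

Lemma cert_2_2_2 : refutes admissible
  [:: Reveal 1; Reveal 2; Delete [:: 0]; Delete [:: 0]; Delete [:: 2]; Reveal 2; Delete [:: 0];
      Reveal 3; Delete [:: 1]; Reveal 4; Delete [:: 2]; Delete [:: 1; 4]; Delete [:: 4];
      Delete [:: 0; 5]; Delete [:: 3]; Delete [:: 0; 3]; Delete [:: 2]; Delete [:: 1];
      Delete [:: 0]]
  [:: ([:: 2; 2; 2], [:: (0, 1); (0, 2)])].
Proof. by vm_compute. Qed.

Lemma cert_3_222 : refutes admissible
  [:: Reveal 1; Reveal 2; Delete [:: 0]; Delete [:: 0]; Delete [:: 2]; Delete [:: 0]; Reveal 2;
      Delete [:: 0]; Reveal 3; Delete [:: 0]; Delete [:: 0]; Delete [:: 3]; Delete [:: 2];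
      Delete [:: 0]; Delete [:: 1]; Delete [:: 0]; Delete [:: 0]]
  [:: ([:: 3; 2; 2; 2], [:: (0, 1); (0, 2); (0, 3)])].
Proof. by vm_compute. Qed.

Lemma cert_triangle_322 : refutes admissible
  [:: Reveal 0; Delete [:: 1]; Delete [:: 0]; Delete [:: 0]]
  [:: ([:: 3; 2; 2], [:: (0, 1); (0, 2); (1, 2)])].
Proof. by vm_compute. Qed.

Lemma cert_two_threads : refutes admissible
  [:: Reveal 3; Reveal 0; Reveal 4; Reveal 5; Delete [:: 3]; Delete [:: 2; 3]; Reveal 8;
      Delete [:: 5]; Reveal 9; Delete [:: 5]; Delete [:: 5]; Delete [:: 9]; Delete [:: 5];
      Delete [:: 5]; Delete [:: 8]; Delete [:: 5]; Delete [:: 5]; Delete [:: 5]; Reveal 6;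
      Delete [:: 0]; Delete [:: 0; 5]; Delete [:: 0; 5]; Delete [:: 0; 5]; Delete [:: 6];
      Delete [:: 6]; Delete [:: 0]; Delete [:: 0; 5]; Delete [:: 0; 5]; Delete [:: 0];
      Delete [:: 5]; Delete [:: 5]; Delete [:: 0]; Delete [:: 5]; Delete [:: 5]; Delete [:: 3];
      Reveal 6; Delete [:: 0]; Delete [:: 0; 5]; Delete [:: 1; 6]; Delete [:: 0]; Delete [:: 5];
      Delete [:: 5]; Delete [:: 3]; Reveal 7; Delete [:: 4]; Reveal 6; Delete [:: 0]; Reveal 8;
      Delete [:: 0; 5]; Delete [:: 1; 4; 8]; Delete [:: 8]; Delete [:: 10]; Reveal 9;
      Delete [:: 0; 7]; Delete [:: 2; 3; 9]; Delete [:: 9]; Delete [:: 10]; Delete [:: 11];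
      Reveal 10; Delete [:: 3; 4; 6]; Delete [:: 3; 4; 6]; Delete [:: 10]; Delete [:: 1; 4; 8];
      Delete [:: 1; 4; 10]; Delete [:: 6]; Delete [:: 3; 4; 6]; Delete [:: 6]; Delete [:: 6];
      Delete [:: 0; 5]; Delete [:: 0; 5]; Delete [:: 6]; Delete [:: 0; 7]; Delete [:: 0; 7];
      Delete [:: 6]; Delete [:: 6]; Delete [:: 7]; Delete [:: 4]; Delete [:: 5]; Delete [:: 5];
      Delete [:: 3]; Delete [:: 1; 4]; Delete [:: 4]; Delete [:: 1; 4]; Reveal 6; Delete [:: 0];
      Delete [:: 0]; Delete [:: 6]; Delete [:: 0]; Delete [:: 0]; Delete [:: 0]; Reveal 5;
      Delete [:: 3]; Delete [:: 3]; Delete [:: 5]; Delete [:: 3]; Delete [:: 3]; Delete [:: 0];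
      Delete [:: 3]]
  [:: ([:: 3; 2; 2; 2; 2], [:: (0, 1); (0, 2); (1, 3); (2, 4)])].
Proof. by vm_compute. Qed.

Lemma cert_thread_end : refutes admissible
  [:: Reveal 2; Delete [:: 1]; Reveal 5; Delete [:: 2]; Delete [:: 2]; Delete [:: 5];
      Delete [:: 2]; Delete [:: 2]; Delete [:: 2]]
  [:: ([:: 3; 2; 2; 3; 3], [:: (0, 1); (1, 2); (0, 3); (0, 4)])].
Proof. by vm_compute. Qed.

Lemma cert_no_thread : refutes admissible
  [:: Reveal 3; Delete [:: 0]; Delete [:: 0]; Delete [:: 0]; Delete [:: 0]; Delete [:: 3];
      Delete [:: 3]]
  [:: ([:: 3; 2; 2; 3; 3; 3], [:: (0, 1); (0, 2); (0, 3); (1, 4); (2, 5)])].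
Proof. by vm_compute. Qed.

Lemma cert_no_thread_triangle : refutes admissible
  [:: Delete [:: 0]]
  [:: ([:: 3; 2; 2; 3; 3], [:: (0, 1); (0, 2); (0, 3); (1, 3); (2, 4)])].
Proof. by vm_compute. Qed.

Lemma cert_support_nbr_33 : refutes admissible
  [:: Reveal 1; Reveal 5; Delete [:: 1]; Delete [:: 1]; Delete [:: 1]; Delete [:: 1];
      Delete [:: 1]; Delete [:: 5]; Delete [:: 1]; Delete [:: 1]; Delete [:: 1]; Delete [:: 1]]
  [:: ([:: 3; 3; 1; 3; 3], [:: (0, 1); (1, 2); (0, 3); (0, 4)])].
Proof. by vm_compute. Qed.

Lemma cert_support_nbr_23 : refutes admissible
  [:: Reveal 1; Reveal 5; Delete [:: 1]; Delete [:: 1]; Delete [:: 1]; Delete [:: 1];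
      Delete [:: 5]; Delete [:: 5]; Delete [:: 1]; Delete [:: 1]; Delete [:: 1]; Delete [:: 1]]
  [:: ([:: 3; 3; 1; 2; 3], [:: (0, 1); (1, 2); (0, 3); (0, 4)])].
Proof. by vm_compute. Qed.

Lemma cert_thread_nbr_33 : refutes ok_thread
  [:: Reveal 2; Delete [:: 0]; Reveal 3; Delete [:: 0]; Delete [:: 3]; Delete [:: 2]]
  [:: ([:: 3; 3; 2; 2; 3; 3], [:: (0, 1); (0, 2); (0, 3); (1, 4); (1, 5)])].
Proof. by vm_compute. Qed.

Lemma cert_thread_nbr_23 : refutes ok_thread
  [:: Reveal 2; Reveal 3; Delete [:: 0]; Delete [:: 0]; Delete [:: 3]; Reveal 3; Delete [:: 0];
      Delete [:: 3]; Delete [:: 2]]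
  [:: ([:: 3; 3; 2; 2; 2; 3], [:: (0, 1); (0, 2); (0, 3); (1, 4); (1, 5)])].
Proof. by vm_compute. Qed.

Lemma cert_thread_nbr_triangle : refutes ok_thread
  [:: Reveal 1; Delete [:: 0]; Delete [:: 0]; Delete [:: 1]]
  [:: ([:: 3; 3; 2; 2], [:: (0, 1); (0, 2); (0, 3); (1, 2)])].
Proof. by vm_compute. Qed.

(** Vertex 0 is not good, having 3 as its only neighbour of degree 2; beyond 3 lies vertex 4, which
    is good because it carries the thread 5, 6. Serves [T_across]. *)
Lemma cert_across : refutes ok_good
  [:: Reveal 6; Reveal 4; Reveal 1; Reveal 2; Delete [:: 0]; Delete [:: 0]; Delete [:: 0];
      Delete [:: 0]; Delete [:: 0]; Delete [:: 0]; Delete [:: 0]; Reveal 2; Delete [:: 0];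
      Delete [:: 0; 5]; Delete [:: 0]; Reveal 7; Delete [:: 0]; Reveal 8; Delete [:: 0];
      Delete [:: 0]; Delete [:: 0; 5]; Reveal 7; Reveal 7; Reveal 8; Reveal 8; Delete [:: 0];
      Delete [:: 0]; Reveal 7; Delete [:: 4]; Reveal 7; Delete [:: 6]; Delete [:: 6];
      Delete [:: 7]; Delete [:: 6]; Delete [:: 6]; Delete [:: 6]; Reveal 1; Reveal 2]
  [:: ([:: 3; 3; 3; 2; 3; 2; 2], [:: (0, 1); (0, 2); (0, 3); (3, 4); (4, 5); (5, 6)])].
Proof. by vm_compute. Qed.

(** * Certificates for the core *)

Lemma cert_core_triangle_333 : refutes ok_core
  [:: Reveal 1; Reveal 2; Delete [:: 0]; Reveal 3; Delete [:: 0]; Delete [:: 0]]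
  [:: ([:: 3; 2; 3; 3], [:: (0, 1); (0, 2); (0, 3); (2, 3)])].
Proof. by vm_compute. Qed.

Lemma cert_core_triangle_233 : refutes ok_core
  [:: Reveal 1; Reveal 2; Delete [:: 0]]
  [:: ([:: 2; 3; 3], [:: (0, 1); (1, 2); (2, 0)])].
Proof. by vm_compute. Qed.

Lemma cert_core_nbr : refutes ok_core
  [:: Reveal 1; Reveal 3; Delete [:: 0]; Delete [:: 0]; Delete [:: 0]]
  [:: ([:: 3; 2; 3; 3; 3; 3], [:: (0, 1); (0, 2); (0, 3); (2, 4); (2, 5)])].
Proof. by vm_compute. Qed.

Lemma cert_core_cubic : refutes ok_even
  [:: Reveal 1; Reveal 2; Reveal 3; Delete [:: 0]; Reveal 3; Delete [:: 0]; Reveal 2; Reveal 3;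
      Delete [:: 0]; Reveal 2; Reveal 3; Delete [:: 0]]
  [:: ([:: 3; 3; 3; 3], [:: (0, 1); (0, 2); (0, 3)])].
Proof. by vm_compute. Qed.

Lemma cert_alpha : refutes (ok_pattern triangles)
  [:: Reveal 4; Reveal 1; Reveal 2; Reveal 3; Reveal 6; Reveal 9; Reveal 8; Delete [:: 1; 3];
      Reveal 10; Delete [:: 3; 6]; Reveal 5; Delete [:: 0; 2; 10]; Delete [:: 1; 5]; Reveal 5;
      Delete [:: 0; 9]; Reveal 5; Reveal 7; Reveal 9; Reveal 11; Delete [:: 4; 6; 7];
      Delete [:: 4; 6; 7]; Delete [:: 1; 5]; Delete [:: 1; 3]; Delete [:: 1; 3]]
  [:: ([:: 2; 3; 3; 3; 3], [:: (0, 1); (1, 2); (2, 3); (3, 4); (4, 0)])].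
Proof. by vm_compute. Qed.

Lemma cert_gamma : refutes (ok_pattern (triangles ++ [:: alpha]))
  [:: Reveal 1; Reveal 4; Reveal 2; Reveal 5; Reveal 6; Reveal 10; Reveal 11; Reveal 12;
      Delete [:: 0; 3; 10]; Reveal 7; Reveal 16; Delete [:: 3; 6; 7]; Delete [:: 0; 3; 10; 16];
      Reveal 14; Delete [:: 0; 3; 10; 16]; Delete [:: 1; 5; 14]; Delete [:: 1; 5; 14];
      Delete [:: 0; 13]; Reveal 9; Reveal 16; Reveal 17; Delete [:: 3; 10; 16];
      Delete [:: 3; 10; 16]; Delete [:: 0; 3; 10; 16]; Delete [:: 3; 10; 16]; Reveal 7;
      Delete [:: 1; 16]; Delete [:: 0; 13]; Delete [:: 2; 6; 17]; Delete [:: 0; 3; 10; 16];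
      Delete [:: 0; 4; 9]; Reveal 14; Delete [:: 3; 10; 16]; Delete [:: 2; 14];
      Delete [:: 2; 5; 14]; Delete [:: 0; 3; 10; 13]; Delete [:: 0; 3; 10]; Reveal 7;
      Delete [:: 2; 6; 12]; Delete [:: 0; 13]; Reveal 7; Reveal 14; Delete [:: 6; 12]; Reveal 9;
      Delete [:: 6; 12]; Reveal 8; Reveal 7; Delete [:: 1; 4; 11]; Delete [:: 1; 4; 11];
      Delete [:: 0; 13]; Delete [:: 1; 5; 8]; Delete [:: 0; 13]; Delete [:: 1; 5; 8]; Reveal 9;
      Delete [:: 2; 6]; Reveal 7; Delete [:: 0; 10]; Reveal 9; Delete [:: 2; 5]]
  [:: ([:: 2; 3; 3; 2; 3; 3; 3], [:: (0, 1); (1, 2); (2, 3); (3, 4); (4, 5); (5, 6); (6, 0)])].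
Proof. by vm_compute. Qed.

Lemma cert_beta : refutes (ok_pattern (triangles ++ [:: alpha; gamma]))
  [:: Reveal 1; Reveal 2; Reveal 3; Reveal 4; Reveal 5; Reveal 6; Reveal 8; Reveal 10; Reveal 13;
      Delete [:: 0; 4; 8]; Reveal 12; Delete [:: 0; 8]]
  [:: ([:: 2; 3; 3; 3; 3; 3; 3], [:: (0, 1); (1, 2); (2, 3); (3, 4); (4, 5); (5, 6); (6, 0)])].
Proof. by vm_compute. Qed.

(** Nothing but one vertex of degree 3 is assumed, so this excludes all such vertices at once. *)
Lemma cert_core_3 : refutes (ok_pattern (triangles ++ [:: alpha; gamma; beta]))
  [:: Reveal 0; Reveal 2; Reveal 1; Reveal 6; Reveal 4; Reveal 7; Reveal 5; Reveal 8;
      Delete [:: 2; 6]; Delete [:: 2; 6]; Reveal 8; Delete [:: 2; 6]; Reveal 7; Delete [:: 1; 4];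
      Reveal 8; Delete [:: 1; 4]]
  [:: ([:: 3], [:: ])].
Proof. by vm_compute. Qed.

(** * Soundness of the rules *)

Definition ndeg (V : finType) (e : rel V) (x : V) (d : nat) : nat :=
  #|[set y in nbhd e x | deg e y == d]|.

Section Counting.
Variables (V : finType) (e : rel V).
Hypothesis He : sparse e.
Variables (f : nat -> V) (c : config).
Hypothesis fc : embeds e f c.

Lemma count_adj_le (P : pred nat) (Q : pred V) i :
  (forall j, j \in adj c i -> P j -> Q (f j)) ->
  count P (adj c i) <= #|[set y in nbhd e (f i) | Q y]|.
Proof.
move=> PQ; rewrite -size_filter -(size_map f) -(card_uniqP _); last first.
  apply: (embeds_uniq fc); first by rewrite filter_uniq ?undup_uniq.
  by move=> j; rewrite mem_filter => /andP[_ /(adj_lt He fc)].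
apply: subset_leq_card; apply/subsetP => y /mapP[j].
rewrite mem_filter => /andP[Pj ij] ->; have [_ _ eij] := embeds_adj He fc ij.
by rewrite !inE eij PQ.
Qed.

Lemma count_adj_full (P : pred nat) (Q : pred V) i :
  i < size c.1 -> full c i -> (forall j, j \in adj c i -> P j = Q (f j)) ->
  count P (adj c i) = #|[set y in nbhd e (f i) | Q y]|.
Proof.
move=> ni fi PQ; apply/eqP; rewrite eqn_leq count_adj_le /=; last by move=> j /PQ->.
rewrite -size_filter -(size_map f); apply: leq_trans (card_size _).
apply: subset_leq_card; apply/subsetP => y; rewrite !inE => /andP[/(fullP He fc ni fi)[j ij ->] Qj].
by rewrite map_f // mem_filter PQ // Qj.
Qed.

Lemma embeds_deg i : i < size c.1 -> deg e (f i) = lab_deg c i.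
Proof. by case: fc => _ + _; apply. Qed.

Lemma embeds_deg_adj i j : j \in adj c i -> deg e (f j) = lab_deg c j.
Proof. by move=> /(adj_lt He fc); apply: embeds_deg. Qed.

Lemma lab_count_le i d : lab_count c i d <= ndeg e (f i) d.
Proof. by apply: count_adj_le => j /embeds_deg_adj->. Qed.

Lemma lab_count_full i d : i < size c.1 -> full c i -> lab_count c i d = ndeg e (f i) d.
Proof. by move=> ni fi; apply: count_adj_full => // j /embeds_deg_adj->. Qed.

Lemma lab_thread_sound i j : j \in adj c i -> lab_thread c j ->
  (deg e (f j) == 2) && (0 < ndeg e (f j) 2).
Proof.
move=> ij /andP[dj /leq_trans->]; last exact: lab_count_le.
by rewrite (embeds_deg_adj ij) dj.
Qed.

(** A repeated label [k] would be joined to [i] through two different neighbours of [i], closing a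
    4-cycle. *)
Lemma admissible_sound : admissible c.
Proof.
have [inj _ _] := fc; have [_ _ _ e4] := He.
apply/allP => i; rewrite mem_iota => /andP[_ ni]; rewrite (size_adj He fc) //=.
rewrite filter_flatten -map_comp.
have: uniq (adj c i) by apply: undup_uniq.
have: {subset adj c i <= adj c i} by [].
elim: {-2}(adj c i) => //= j s IHs sub /andP[js us].
rewrite cat_uniq filter_uniq ?undup_uniq ?IHs //=; last first.
  by move=> k ks; apply: sub; rewrite inE ks orbT.
rewrite andbT; apply/hasPn => k /flatten_mapP[j' j's].
rewrite !mem_filter => /andP[ki j'k]; rewrite ki /=; apply: contra js => jk.
have /(embeds_adj He fc)[_ nj eij] : j \in adj c i by apply: sub; rewrite mem_head.
have /(embeds_adj He fc)[_ nj' eij'] : j' \in adj c i by apply: sub; rewrite inE j's orbT.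
have [_ nk ejk] := embeds_adj He fc jk; have [_ _ ej'k] := embeds_adj He fc j'k.
suff -> : j = j' by [].
apply: (inj) => //; apply: (e4 (f i) (f k)) => //.
by apply: contra_neq ki => fik; apply/esym/inj.
Qed.

Lemma pattern_sound ds : has_pattern c ds -> ds != [::] ->
  exists s : seq V, ucycle e s /\ [seq deg e x | x <- s] = ds.
Proof.
have [inj degf _] := fc; have [e_sym _ _ _] := He.
case: ds => // d0 ds /hasP[i]; rewrite mem_iota => /andP[_ ni] /=.
case: eqP => // di cl _.
(* Generalised to any reversed walk [s] with distinct labels, for induction on the degrees still to
   be visited. *)
suff clP t s : closes c s t -> s != [::] -> uniq s -> {subset s <= gtn (size c.1)} ->
    path (fun j k => k \in adj c j) (head 0 s) (behead s) ->
    exists2 s', ucycle e s' & [seq deg e x | x <- s'] = [seq lab_deg c j | j <- rev s] ++ t.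
  have [] // := clP _ _ cl; first by move=> j; rewrite !inE => /eqP->.
  by move=> s' cs' ds'; exists s'; rewrite ds' /= di.
elim: t s => [|d t IHt] [|j s] //=.
- move=> closed _ us sn jp; exists (map f (rev (j :: s))); last first.
    rewrite cats0 -map_comp; apply/eq_in_map => k; rewrite mem_rev => /sn kn /=; exact: degf.
  apply/andP; split; last first.
    by rewrite (embeds_uniq fc) ?rev_uniq // => k; rewrite mem_rev => /sn.
  rewrite map_rev rev_cycle (eq_cycle (e' := e)); last by move=> x y; apply: e_sym.
  have adje j1 k1 : k1 \in adj c j1 -> e (f j1) (f k1) by case/(embeds_adj He fc).
  rewrite /= rcons_path last_map; apply/andP; split; last by rewrite e_sym adje.
  rewrite path_map; move: jp; apply: sub_path => j1 k1; exact: adje.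
- case/hasP => k kj; case: ifP => // /andP[/eqP dk ks] cl' _ us sn jp.
  have [] // := IHt _ cl'; rewrite /= ?ks //.
    by move=> l; rewrite inE => /predU1P[->|/sn //]; apply: (adj_lt He fc kj).
    by rewrite jp adj_sym kj.
  by move=> s' cs' ds'; exists s'; rewrite // ds' [rev (k :: _)]rev_cons map_rcons cat_rcons dk.
Qed.

End Counting.

(** * Local structure of undeletable graphs *)

Definition undeletable (V : finType) (e : rel V) : Prop :=
  forall I : {set V}, independent e I -> I != set0 -> ~ deletable e I.

Definition good (V : finType) (e : rel V) (x : V) : bool :=
  (deg e x == 3) && ((0 < ndeg e x 1) || (ndeg e x 2 == 2)).

Lemma adjC (V : finType) (e : rel V) (x y : V) : sparse e -> e x y -> e y x.
Proof. by case=> e_sym _ _ _; rewrite e_sym. Qed.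

Lemma neq_adj (V : finType) (e : rel V) (x y : V) : sparse e -> e x y -> x != y.
Proof. by case=> _ e_irr _ _; apply: contraTneq => ->; rewrite e_irr. Qed.

Lemma neq_deg (V : finType) (e : rel V) (x y : V) : deg e x != deg e y -> x != y.
Proof. by apply: contra_neq => ->. Qed.

(** Applies a certificate to actual vertices: labels are positions in [s], and [x0] is the default
    of [nth]. *)
Lemma refute (V : finType) (e : rel V) (ok : pred config) ts ds es (s : seq V) (x0 : V) :
  sparse e -> undeletable e -> (forall f c, embeds e f c -> ok c) -> refutes ok ts [:: (ds, es)] ->
  uniq s -> [seq deg e x | x <- s] = ds ->
  all (fun p => [&& p.1 < size s, p.2 < size s & e (nth x0 s p.1) (nth x0 s p.2)]) es -> False.
Proof.
move=> He irr ok_sound ref us ds_s es_s.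
have fc := embeds_seq (c := (ds, es)) us ds_s es_s.
exact: (refutes_sound He irr ok_sound ref (mem_head _ _) fc).
Qed.

Ltac degs := repeat match goal with dx : deg ?e ?x = _ |- context[deg ?e ?x] => rewrite dx end.
(** Named vertices are distinct by hypothesis, by different degrees, or by adjacency. *)
Ltac neq := lazymatch goal with He : sparse ?e |- _ =>
  by [|rewrite eq_sym|apply: (@neq_deg _ e); degs|apply: (neq_adj He)
      |rewrite eq_sym; apply: (neq_adj He)] end.
Ltac refute_by ok_sound cert x0 labels :=
  exfalso; lazymatch goal with He : sparse ?e, irr : undeletable ?e |- _ =>
    apply: (refute He irr ok_sound cert (s := labels) (x0 := x0)) end;
  [ rewrite /= ?inE ?negb_or; repeat (apply/andP; split); neq
  | rewrite /=; degs; reflexivity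
  | rewrite /=; repeat (apply/andP; split); by [|apply: adjC] ].

Section Facts.
Variables (V : finType) (e : rel V).
Hypotheses (He : sparse e) (irr : undeletable e).

Let e_sym : symmetric e. Proof. by case: He. Qed.
Let e_irr : irreflexive e. Proof. by case: He. Qed.
Let e3 : subcubic e. Proof. by case: He. Qed.
Let e4 : c4_free e. Proof. by case: He. Qed.

Let admP f c : embeds e f c -> admissible c.
Proof. exact: admissible_sound. Qed.

Lemma deg_gt0 x y : e x y -> 0 < deg e x.
Proof. by move=> xy; apply/card_gt0P; exists y; rewrite inE. Qed.

Lemma ndeg_gt0 x y d : e x y -> deg e y = d -> 0 < ndeg e x d.
Proof. by move=> xy dy; apply/card_gt0P; exists y; rewrite !inE xy dy eqxx. Qed.

Lemma ndeg_gt0P x d : 0 < ndeg e x d -> exists2 y, e x y & deg e y = d.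
Proof. by case/card_gt0P => y; rewrite !inE => /andP[xy /eqP dy]; exists y. Qed.

Lemma ndeg_gt1 x y z d : e x y -> e x z -> y != z -> deg e y = d -> deg e z = d -> 1 < ndeg e x d.
Proof.
by move=> xy xz yz dy dz; apply/card_gt1P; exists y, z; split; rewrite // !inE ?xy ?xz ?dy ?dz eqxx.
Qed.

Lemma ndeg_gt1P x d : 1 < ndeg e x d ->
  exists y z, [/\ e x y, e x z, y != z, deg e y = d & deg e z = d].
Proof.
case/card_gt1P => y [z []]; rewrite !inE => /andP[xy /eqP dy] /andP[xz /eqP dz] yz.
by exists y, z.
Qed.

Lemma deg2_other x y : deg e x = 2 -> e x y ->
  exists z, [/\ e x z, z != y & forall w, e x w -> w \in [:: y; z]].
Proof.
move=> dx xy; have := cardsD1 y (nbhd e x).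
rewrite inE xy -/(deg e x) dx add1n => /esym/eqP; rewrite eqSS.
move/cards1P => [z zE]; have : z \in nbhd e x :\ y by rewrite zE set11.
rewrite !inE => /andP[zy xz]; exists z; split=> // w xw.
rewrite !inE; have [//|wy /=] := eqVneq w y.
have : w \in nbhd e x :\ y by rewrite !inE wy.
by rewrite zE inE.
Qed.

Lemma deg3_others x y : deg e x = 3 -> e x y ->
  exists s t, [/\ [/\ e x s, e x t & s != t], s != y, t != y &
    forall w, e x w -> w \in [:: y; s; t]].
Proof.
move=> dx xy; have := cardsD1 y (nbhd e x).
rewrite inE xy -/(deg e x) dx add1n => /esym/eqP; rewrite eqSS.
move/cards2P => [s [t [st stE]]].
have : s \in nbhd e x :\ y by rewrite stE set21.
have : t \in nbhd e x :\ y by rewrite stE set22.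
rewrite !inE => /andP[ty xt] /andP[sy xs]; exists s, t; split=> // w xw.
rewrite !inE; have [//|wy /=] := eqVneq w y.
have : w \in nbhd e x :\ y by rewrite !inE wy.
by rewrite stE !inE.
Qed.

(** A vertex of degree 0 weighs exactly 14, so it can be deleted alone. *)
Lemma no_isolated x : deg e x <> 0.
Proof.
move=> dx; have cert0 : refutes admissible [:: Delete [:: 0]] [:: ([:: 0], [::])] by [].
by apply: (refute He irr admP cert0 (s := [:: x]) (x0 := x)); rewrite //= dx.
Qed.

Lemma leaf_nbr l u : deg e l = 1 -> e l u ->
  deg e u = 3 /\ forall y, e u y -> y != l -> deg e y = 3.
Proof.
move=> dl lu; have ul : e u l by rewrite e_sym.
have du : deg e u = 3.
  case du: (deg e u) (e3 u) (deg_gt0 ul) => [|[|[|[|]]]] // _ _.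
    refute_by admP cert_leaf_leaf l [:: l; u].
  refute_by admP cert_leaf_2 l [:: l; u].
split=> // y uy yl.
have yu : e y u by rewrite e_sym.
case dy: (deg e y) (e3 y) (deg_gt0 yu) => [|[|[|[|]]]] // _ _.
  refute_by admP cert_3_leaf_leaf l [:: u; l; y].
refute_by admP cert_3_leaf_2 l [:: u; l; y].
Qed.

Lemma deg_nbr x y : e x y -> deg e y \in [:: 1; 2; 3].
Proof.
by rewrite e_sym => /deg_gt0; case: (deg e y) (e3 y) => [|[|[|[|]]]].
Qed.

Lemma deg2_ndeg2 z : deg e z = 2 -> ndeg e z 2 <= 1.
Proof.
move=> dz; rewrite leqNgt; apply/negP => /ndeg_gt1P[x [y [zx zy xy dx dy]]].
refute_by admP cert_2_2_2 z [:: z; x; y].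
Qed.

Lemma deg3_ndeg2 x : deg e x = 3 -> ndeg e x 2 <= 2.
Proof.
move=> dx; rewrite leqNgt; apply/negP => /card_gt2P[y [z [w]]].
rewrite !inE => -[[/andP[xy /eqP dy] /andP[xz /eqP dz] /andP[xw /eqP dw]] [yz zw wy]].
refute_by admP cert_3_222 x [:: x; y; z; w].
Qed.

Lemma no_two_threads x y z : deg e x = 3 -> e x y -> e x z -> y != z ->
  deg e y = 2 -> deg e z = 2 -> 0 < ndeg e y 2 -> 0 < ndeg e z 2 -> False.
Proof.
move=> dx xy xz yz dy dz /ndeg_gt0P[y' yy' dy'] /ndeg_gt0P[z' zz' dz'].
have [zy|zNy] := boolP (e y z); first by refute_by admP cert_triangle_322 x [:: x; y; z].
have y'z : y' != z by apply: contraNneq zNy => <-.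
have z'y : z' != y by apply: contraNneq zNy => <-; rewrite e_sym.
(* Otherwise [x], [y], [y'], [z] would form a 4-cycle. *)
have y'z' : y' != z'.
  apply/eqP => E; move/eqP: yz; apply; apply: (e4 (a := x) (b := y')) => //.
  - by rewrite E.
  - neq.
refute_by admP cert_two_threads x [:: x; y; z; y'; z'].
Qed.

Lemma ok_thread_sound f c : embeds e f c -> ok_thread c.
Proof.
move=> fc; rewrite /ok_thread (admissible_sound He fc); apply/allP => i.
rewrite mem_iota => /andP[_ ni]; apply/implyP => /eqP di.
apply: leq_trans (_ : #|[set z in nbhd e (f i) | (deg e z == 2) && (0 < ndeg e z 2)]| <= _).
  by apply: (count_adj_le He fc) => j; apply: (lab_thread_sound He fc).
rewrite leqNgt; apply/negP => /card_gt1P[y [z []]].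
rewrite !inE => /and3P[xy /eqP dy y2] /and3P[xz /eqP dz z2] yz.
have di' : deg e (f i) = 3 by rewrite (embeds_deg fc).
exact: (no_two_threads di' xy xz yz dy dz y2 z2).
Qed.

(** If [z] were the only neighbour of degree 2, the other two would have degree 3, since a leaf at
    [x] forces degree 3 on [z]. A certificate excludes this. *)
Lemma thread_end x z : deg e x = 3 -> e x z -> deg e z = 2 -> 0 < ndeg e z 2 ->
  ndeg e x 2 = 2.
Proof.
move=> dx xz dz /ndeg_gt0P[y zy dy]; apply/eqP; rewrite eqn_leq deg3_ndeg2 // ltnNge.
apply/negP => k1; have [s [t [[xs xt st] sz tz _]]] := deg3_others dx xz.
have deg3 w : e x w -> w != z -> deg e w = 3.
  move=> xw wz; have := deg_nbr xw; rewrite !inE => /or3P[] /eqP dw //.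
    have wx : e w x by rewrite e_sym.
    by have [_ /(_ z xz)] := leaf_nbr dw wx; rewrite eq_sym wz dz => /(_ isT).
  by have := ndeg_gt1 xw xz wz dw dz; rewrite ltnNge k1.
have ds := deg3 _ xs sz; have dt := deg3 _ xt tz.
refute_by admP cert_thread_end x [:: x; z; y; s; t].
Qed.

(** By [no_two_threads] at most one of the two neighbours of degree 2 lies on a thread. If neither
    does, both lead on to vertices of degree 3, which certificates exclude. *)
Lemma T_nbrs x : deg e x = 3 -> ndeg e x 2 = 2 ->
  exists z q r, [/\ [/\ e x z, e x q & e x r], [/\ deg e z = 2, deg e q = 2 & deg e r = 3],
    z != q, 0 < ndeg e z 2 & ndeg e q 2 = 0].
Proof.
move=> dx k2; have [|a [b [xa xb ab da db]]] := @ndeg_gt1P x 2; first by rewrite k2.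
have [s [t [[xs xt st] sa ta all_x]]] := deg3_others dx xa.
have [r [xr ra rb]] : exists r, [/\ e x r, r != a & r != b].
  have := all_x b xb; rewrite !inE (eq_sym b) (negPf ab) /= => /orP[] /eqP bE; subst b.
    by exists t; split=> //; rewrite eq_sym.
  by exists s.
have dr : deg e r = 3.
  have := deg_nbr xr; rewrite !inE => /or3P[] /eqP dr //.
    have rx : e r x by rewrite e_sym.
    by have [_ /(_ a xa)] := leaf_nbr dr rx; rewrite eq_sym ra da => /(_ isT).
  suff : 2 < ndeg e x 2 by rewrite k2.
  apply/card_gt2P; exists a, b, r; rewrite !inE xa xb xr da db dr eqxx.
  by rewrite (eq_sym b) rb ra ab.
have [a2|a2] := posnP (ndeg e a 2); last first.
  have [b2|b2] := posnP (ndeg e b 2); last by case: (no_two_threads dx xa xb ab).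
  by exists a, b, r.
have [b2|b2] := posnP (ndeg e b 2); last by exists b, a, r; rewrite eq_sym.
have other y : e x y -> deg e y = 2 -> ndeg e y 2 = 0 ->
    exists y', [/\ e y y', y' != x & deg e y' = 3].
  move=> xy dy y2; have yx : e y x by rewrite e_sym.
  have [y' [yy' y'x _]] := deg2_other dy yx; exists y'; split=> //.
  have := deg_nbr yy'; rewrite !inE => /or3P[] /eqP dy' //.
    have y'y : e y' y by rewrite e_sym.
    by have [] := leaf_nbr dy' y'y; rewrite dy.
  by have := ndeg_gt0 yy' dy'; rewrite y2.
have [a' [aa' a'x da']] := other a xa da a2; have [b' [bb' b'x db']] := other b xb db b2.
have a'b' : a' != b'.
  apply/eqP => E; move/eqP: ab; apply; apply: (e4 (a := x) (b := a')) => //.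
  - by rewrite E.
  - by rewrite eq_sym.
(* If the next vertex is the third neighbour [r] of [x], a triangle arises, which is a separate
   configuration. *)
have [a'r|a'r] := eqVneq a' r.
  by subst a'; refute_by admP cert_no_thread_triangle x [:: x; a; b; r; b'].
have [b'r|b'r] := eqVneq b' r.
  by subst b'; refute_by admP cert_no_thread_triangle x [:: x; b; a; r; a'].
refute_by admP cert_no_thread x [:: x; a; b; r; a'; b'].
Qed.

(** If [v] is not good, its neighbours other than [u] have degrees 3 and 3, or 2 and 3. Each case is
    excluded both for [u] with a leaf and for [u] with two neighbours of degree 2. *)
Lemma good_nbr u v : good e u -> e u v -> deg e v = 3 -> good e v.
Proof.
case/andP => /eqP du gu uv dv; apply: contraT; rewrite /good dv eqxx /= negb_or -leqNgt leqn0.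
case/andP => /eqP v1 v2; have vu : e v u by rewrite e_sym.
have {}v2 : ndeg e v 2 <= 1 by rewrite -ltnS ltn_neqAle v2 deg3_ndeg2.
have [s [t [[vs vt st] su tu _]]] := deg3_others dv vu.
wlog dt : s t vs vt st su tu / deg e t = 3 => [hw|].
  have := deg_nbr vt; rewrite !inE => /or3P[] /eqP dt.
  - by have := ndeg_gt0 vt dt; rewrite v1.
  - apply: (hw t s); rewrite // 1?eq_sym //.
    have := deg_nbr vs; rewrite !inE => /or3P[] /eqP ds //.
      by have := ndeg_gt0 vs ds; rewrite v1.
    by have := ndeg_gt1 vs vt st ds dt; rewrite ltnNge v2.
  - exact: (hw s t).
have ds : deg e s = 2 \/ deg e s = 3.
  have := deg_nbr vs; rewrite !inE => /or3P[] /eqP ds; [|by left|by right].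
  by have := ndeg_gt0 vs ds; rewrite v1.
case/orP: gu => [/ndeg_gt0P[l ul dl]|/eqP u2].
  case: ds => ds; first by refute_by admP cert_support_nbr_23 u [:: v; u; l; s; t].
  by refute_by admP cert_support_nbr_33 u [:: v; u; l; s; t].
have [|a [b [ua ub ab da db]]] := @ndeg_gt1P u 2; first by rewrite u2.
case: ds => ds; last by refute_by ok_thread_sound cert_thread_nbr_33 u [:: u; v; a; b; s; t].
(* A neighbour of degree 2 shared by [u] and [v] gives a triangle. *)
have [sa|sa] := eqVneq s a; first subst s.
  by refute_by ok_thread_sound cert_thread_nbr_triangle u [:: u; v; a; b].
have [sb|sb] := eqVneq s b; first subst s.
  by refute_by ok_thread_sound cert_thread_nbr_triangle u [:: u; v; b; a].
by refute_by ok_thread_sound cert_thread_nbr_23 u [:: u; v; a; b; s; t].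
Qed.

Lemma lab_good_sound f c i : embeds e f c -> i < size c.1 -> lab_good c i -> good e (f i).
Proof.
move=> fc ni /andP[di gi]; rewrite /good (embeds_deg fc) // di /=.
case/orP: gi => [i1|/andP[fi i2]]; first by rewrite (leq_trans i1) ?(lab_count_le He fc).
by rewrite -(lab_count_full He fc 2 ni fi) i2 orbT.
Qed.

Lemma ok_good_sound f c : embeds e f c -> ok_good c.
Proof.
move=> fc; rewrite /ok_good (admissible_sound He fc); apply/allP => i.
rewrite mem_iota => /andP[_ ni]; apply/andP; split.
  apply/implyP => /(lab_good_sound fc ni) gi; apply/hasPn => j ij.
  have [_ nj eij] := embeds_adj He fc ij; apply/and4P => -[/eqP dj fj j1 j2].
  have dfj : deg e (f j) = 3 by rewrite (embeds_deg fc).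
  have := good_nbr gi eij dfj; rewrite /good dfj eqxx /=.
  by rewrite -(lab_count_full He fc 1 nj fj) -(lab_count_full He fc 2 nj fj) lt0n j1 (negPf j2).
apply/implyP => /and3P[/eqP di fi /hasP[j ij /(lab_thread_sound He fc ij) /andP[/eqP dj j2]]].
have [_ _ eij] := embeds_adj He fc ij.
by rewrite (lab_count_full He fc 2 ni fi) (thread_end _ eij) // (embeds_deg fc).
Qed.

(** Otherwise [q] is the only neighbour of degree 2 of [y]. As [q] also excludes leaves at [y], [y]
    is not good, while [x] is good and has a thread by [T_nbrs]. *)
Lemma T_across x q y : deg e x = 3 -> ndeg e x 2 = 2 -> e x q -> deg e q = 2 -> ndeg e q 2 = 0 ->
  e q y -> y != x -> deg e y = 3 /\ ndeg e y 2 = 2.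
Proof.
move=> dx x2 xq dq q2 qy yx; have yq : e y q by rewrite e_sym.
have leafq w : e w q -> deg e w != 1.
  by move=> wq; apply/eqP => /leaf_nbr/(_ wq)[]; rewrite dq.
have dy : deg e y = 3.
  have := deg_nbr qy; rewrite !inE => /or3P[] /eqP dy //; first by have := leafq y yq; rewrite dy.
  by have := ndeg_gt0 qy dy; rewrite q2.
split=> //; apply/eqP; rewrite eqn_leq deg3_ndeg2 // ltnNge; apply/negP => y2.
have gx : good e x by rewrite /good dx x2 eqxx orbT.
have noleaf w : e y w -> deg e w != 1.
  move=> yw; apply/eqP => dw; have wy : e w y by rewrite e_sym.
  have wq : q != w by neq.
  by have [_ /(_ q yq wq)] := leaf_nbr dw wy; rewrite dq.
have bad_y : ~~ good e y.
  rewrite /good dy eqxx negb_or -leqNgt leqn0 /=; apply/andP; split.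
    rewrite -leqn0 leqNgt; apply/negP => /ndeg_gt0P[w yw dw].
    by have := noleaf w yw; rewrite dw.
  by apply: contraTneq y2 => ->.
have [s [t [[ys yt st] sq tq _]]] := deg3_others dy yq.
have deg3 w : e y w -> w != q -> deg e w = 3.
  move=> yw wq; have := deg_nbr yw; rewrite !inE => /or3P[] /eqP dw //.
    by have := noleaf w yw; rewrite dw.
  by have := ndeg_gt1 yw yq wq dw dq; rewrite ltnNge y2.
have ds := deg3 _ ys sq; have dt := deg3 _ yt tq.
(* An edge from [y] to the good vertex [x] would make [y] good. *)
have notx w : e y w -> w != x.
  move=> yw; apply: contra bad_y => /eqP E; apply: (good_nbr gx) => //.
  by rewrite -E e_sym.
have sx := notx _ ys; have tx := notx _ yt.
have [z [q' [r [[xz xq' xr] [dz dq' dr] zq' z2 q'2]]]] := T_nbrs dx x2.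
have zq : z != q by apply: contraTneq z2 => ->; rewrite q2.
have [z' zz' dz'] := ndeg_gt0P z2.
have z'q : z' != q.
  apply/eqP => E; have qz : e q z by rewrite e_sym -E.
  by have := ndeg_gt0 qz dz; rewrite q2.
refute_by ok_good_sound cert_across x [:: y; s; t; q; x; z; z'].
Qed.

End Facts.

(** * Elimination of leaves and threads *)

(** Both sides are compared with the number of edges between [A] and [B]. *)
Lemma double_count (V : finType) (e : rel V) (A B : {set V}) m n :
  symmetric e -> (forall a, a \in A -> m <= #|nbhd e a :&: B|) ->
  (forall b, b \in B -> #|nbhd e b :&: A| <= n) -> m * #|A| <= n * #|B|.
Proof.
move=> e_sym mA nB; rewrite mulnC -sum_nat_const mulnC -sum_nat_const.
have cardE x (X : {set V}) : #|nbhd e x :&: X| = \sum_(y in X) e x y.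
  rewrite -sum1_card [LHS]big_mkcond [RHS]big_mkcond; apply: eq_bigr => y _.
  by rewrite !inE; case: (e x y); case: (y \in X).
apply: (@leq_trans (\sum_(a in A) \sum_(b in B) e a b)).
  by apply: leq_sum => a /mA; rewrite cardE.
rewrite exchange_big; apply: leq_sum => b /nB; rewrite cardE.
by under eq_bigr do rewrite e_sym.
Qed.

Section Gadgets.
Variables (V : finType) (e : rel V).
Hypotheses (He : sparse e) (irr : undeletable e).

Let e_sym : symmetric e. Proof. by case: He. Qed.
Let e_irr : irreflexive e. Proof. by case: He. Qed.
Let e3 : subcubic e. Proof. by case: He. Qed.

(* [S] and [T] are the two kinds of good vertices.  [D] is the set of thread vertices, of which
   [Z] keeps one per thread, and a vertex of [Q] joins two vertices of [T]. *)
Let L := [set x | deg e x == 1].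
Let S := [set x | (deg e x == 3) && (0 < ndeg e x 1)].
Let T := [set x | (deg e x == 3) && (ndeg e x 2 == 2)].
Let D := [set x | (deg e x == 2) && (0 < ndeg e x 2)].
Let Q := [set x | [&& deg e x == 2, ndeg e x 2 == 0 & [exists y in T, e x y]]].
Let Z := [set x in D | [exists y, [&& e x y, deg e y == 2 & enum_rank x < enum_rank y]]].
Let I := L :|: Q :|: Z.
Let K := L :|: S :|: T :|: Q :|: D.

Let leaf_far x y w : e x y -> deg e y = 1 -> e x w -> deg e w != 2.
Proof.
move=> xy dy xw; have yx : e y x by rewrite e_sym.
have [_ h] := leaf_nbr He irr dy yx; apply/eqP => dw.
have wy : w != y by apply: (@neq_deg _ e); rewrite dw dy.
by have := h w xw wy; rewrite dw.
Qed.

Let leaf_nbr2 x y : e x y -> deg e x = 2 -> deg e y != 1.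
Proof.
move=> xy dx; apply/eqP => dy; have yx : e y x by rewrite e_sym.
by have [] := leaf_nbr He irr dy yx; rewrite dx.
Qed.

Let two_nbr_uniq x y z : deg e x = 2 -> e x y -> e x z -> deg e y = 2 -> deg e z = 2 -> y = z.
Proof.
move=> dx xy xz dy dz; apply/eqP; apply: contraT => yz.
by have := deg2_ndeg2 He irr dx; rewrite leqNgt (ndeg_gt1 xy xz yz dy dz).
Qed.

(** A vertex of degree 2 has at most one neighbour of degree 2, so [y] is the witness in the
    definition of [Z]. Hence [Z] never contains both vertices of a thread. *)
Let Z_rank x y : x \in Z -> e x y -> deg e y = 2 -> enum_rank x < enum_rank y.
Proof.
rewrite !inE => /andP[/andP[/eqP dx _] /existsP[z /and3P[xz /eqP dz lt_xz]]] xy dy.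
by rewrite (two_nbr_uniq dx xy xz).
Qed.

Let Z_or x y : deg e x = 2 -> deg e y = 2 -> e x y -> (x \in Z) || (y \in Z).
Proof.
move=> dx dy xy; have yx : e y x by rewrite e_sym.
rewrite !inE dx dy (ndeg_gt0 xy dy) (ndeg_gt0 yx dx) /=.
have [lt_xy|lt_yx|eq_xy] := ltngtP (enum_rank x) (enum_rank y).
- by apply/orP; left; apply/existsP; exists y; rewrite xy dy lt_xy.
- by apply/orP; right; apply/existsP; exists x; rewrite yx dx lt_yx.
- by move: xy; rewrite (enum_rank_inj (val_inj eq_xy)) e_irr.
Qed.

Let Q_nbr x y : x \in Q -> e x y -> y \in T.
Proof.
rewrite !inE => /and3P[/eqP dx /eqP x2 /exists_inP[t]].
rewrite inE => /andP[/eqP dt /eqP t2] xt xy; have tx : e t x by rewrite e_sym.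
have [->|yt] := eqVneq y t; first by rewrite dt t2.
by have [-> ->] := T_across He irr dt t2 tx dx x2 xy yt.
Qed.

Let D_nbr x y : x \in D -> e x y -> (y \in T) || (y \in D).
Proof.
rewrite !inE => /andP[/eqP dx x2] xy; have yx : e y x by rewrite e_sym.
have := deg_nbr He xy; rewrite !inE => /or3P[] /eqP dy.
- by have := leaf_nbr2 xy dx; rewrite dy.
- by rewrite dy (ndeg_gt0 yx dx) orbT.
- by rewrite dy (thread_end He irr dy yx dx x2).
Qed.

Let good_in x : good e x -> (x \in S) || (x \in T).
Proof. by rewrite !inE => /andP[-> /=]. Qed.

(** Leaves lead to [S], [Q] to [T], and [D] to [T] or [D]; good vertices lead to leaves, [Q], [D] or
    good vertices. *)
Let K_closed x y : x \in K -> e x y -> y \in K.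
Proof.
rewrite 4!inE => xK xy; have yx : e y x by rewrite e_sym.
have big : good e x -> y \in K.
  move=> gx; have := deg_nbr He xy; rewrite !inE => /or3P[] /eqP dy.
  - by rewrite dy.
  - have dx : deg e x = 3 by case/andP: gx => /eqP.
    rewrite dy /=; have [y2|y2] := posnP (ndeg e y 2); last by rewrite orbT.
    rewrite orbF /=; apply/exists_inP; exists x => //.
    (* A vertex with a leaf has no neighbour of degree 2, so [x] lies in [T]. *)
    rewrite inE dx /=; case/andP: gx => _ /orP[/ndeg_gt0P[l xl dl]|//].
    by have := leaf_far xl dl xy; rewrite dy.
  - by have := good_in (good_nbr He irr gx xy dy); rewrite !inE => /orP[] ->; rewrite ?orbT.
case/orP: xK => [/orP[/orP[/orP[xL|xS]|xT]|xQ]|xD].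
- move: xL; rewrite inE => /eqP dx; have [dy _] := leaf_nbr He irr dx xy.
  by rewrite !inE dy (ndeg_gt0 yx dx) orbT.
- by apply: big; move: xS; rewrite inE /good => /andP[-> ->].
- by apply: big; move: xT; rewrite inE /good => /andP[-> ->]; rewrite orbT.
- by have := Q_nbr xQ xy; rewrite !in_setU => ->; rewrite orbT.
- by have := D_nbr xD xy; rewrite !in_setU => /orP[] ->; rewrite ?orbT.
Qed.

Let I_sub_K x : x \in I -> x \in K.
Proof.
rewrite !in_setU => /orP[/orP[->//|->]|]; first by rewrite orbT.
by rewrite inE => /andP[-> _]; rewrite orbT.
Qed.

(** [S] is dominated by the leaves, [T] by [Q] through [T_nbrs], and [D] by [Z]. *)
Let K_closure : closed_nbhd e I = K.
Proof.
apply/setP => x; apply/idP/idP.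
  rewrite inE => /orP[/I_sub_K //|/exists_inP[y /I_sub_K yK]]; exact: K_closed.
have nbrI y : y \in I -> e x y -> x \in closed_nbhd e I.
  by move=> yI xy; rewrite inE; apply/orP; right; apply/exists_inP; exists y; rewrite // e_sym.
have inI : x \in I -> x \in closed_nbhd e I by move=> xI; rewrite inE xI.
rewrite 4!in_setU => /orP[/orP[/orP[/orP[xL|xS]|xT]|xQ]|xD].
- by apply: inI; rewrite !in_setU xL.
- move: xS; rewrite inE => /andP[_ /ndeg_gt0P[l xl dl]].
  by apply: (nbrI l) => //; rewrite !in_setU inE dl.
- have /andP[/eqP dx /eqP x2] : (deg e x == 3) && (ndeg e x 2 == 2) by move: xT; rewrite inE.
  have [z [q [r [[_ xq _] [_ dq _] _ _ q2]]]] := T_nbrs He irr dx x2.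
  apply: (nbrI q) => //; rewrite !in_setU; apply/orP; left; apply/orP; right.
  by rewrite inE dq q2 /=; apply/exists_inP; exists x; rewrite // e_sym.
- by apply: inI; rewrite !in_setU xQ orbT.
- move: xD; rewrite inE => /andP[/eqP dx /ndeg_gt0P[y xy dy]].
  have /orP[xZ|yZ] := Z_or dx dy xy; first by apply: inI; rewrite !in_setU xZ orbT.
  by apply: (nbrI y) => //; rewrite !in_setU yZ orbT.
Qed.

Let I_deg x : x \in I -> deg e x = 1 \/ deg e x = 2.
Proof.
rewrite !in_setU => /orP[/orP[]|]; rewrite !inE.
- by move/eqP; left.
- by case/and3P => /eqP; right.
- by case/andP => /andP[/eqP]; right.
Qed.

(** Leaves are adjacent only to vertices of degree 3. Two adjacent vertices of degree 2 in [I] would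
    both lie in [Z], with contradictory ranks. *)
Let I_indep : independent e I.
Proof.
apply/forall_inP => x xI; apply/forall_inP => y yI; apply/negP => xy.
have yx : e y x by rewrite e_sym.
case: (I_deg xI) => dx.
  by have [dy _] := leaf_nbr He irr dx xy; case: (I_deg yI); rewrite dy.
case: (I_deg yI) => dy; first by have := leaf_nbr2 xy dx; rewrite dy.
have inZ u w : u \in I -> deg e u = 2 -> e u w -> deg e w = 2 -> u \in Z.
  rewrite !in_setU => /orP[/orP[]|//] uI du uw dw; move: uI; rewrite inE du //.
  by case/and3P => _ /eqP u2 _; have := ndeg_gt0 uw dw; rewrite u2.
have := Z_rank (inZ x y xI dx xy dy) xy dy.
by rewrite ltnNge ltnW // (Z_rank (inZ y x yI dy yx dx) yx dx).
Qed.

(* Weights: [9 L + 5 S >= 14 L] and [5 T + 6 Q + 6 D >= 14 (Q + Z)]. *)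
Let card_L : #|L| <= #|S|.
Proof.
rewrite -[#|L|]mul1n -[#|S|]mul1n; apply: (double_count e_sym) => x.
  rewrite inE => /eqP dx; have /card_gt0P[y] : 0 < #|nbhd e x| by rewrite -/(deg e x) dx.
  rewrite inE => xy; have [dy _] := leaf_nbr He irr dx xy; apply/card_gt0P; exists y.
  by rewrite !inE xy dy (ndeg_gt0 (y := x)) // e_sym.
move=> _; rewrite leqNgt; apply/negP => /card_gt1P[y [z []]].
rewrite !inE => /andP[xy /eqP dy] /andP[xz /eqP dz] yz; have yx : e y x by rewrite e_sym.
by have [_ /(_ z xz)] := leaf_nbr He irr dy yx; rewrite eq_sym yz dz => /(_ isT).
Qed.

(** Both neighbours of a vertex of [Q] are in [T]; a vertex of [T] has at most one neighbour in [Q],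
    as its other neighbour of degree 2 is on a thread. *)
Let card_Q : 2 * #|Q| <= #|T|.
Proof.
rewrite -[#|T|]mul1n; apply: (double_count e_sym) => x xx.
  have dx : deg e x = 2 by move: xx; rewrite inE => /and3P[/eqP].
  rewrite -[X in X <= _]dx; apply: subset_leq_card; apply/subsetP => y; rewrite inE => xy.
  by rewrite !in_setI inE xy (Q_nbr xx xy).
have /andP[/eqP dx /eqP x2] : (deg e x == 3) && (ndeg e x 2 == 2) by move: xx; rewrite inE.
have [z [q [r [[xz _ _] [dz _ _] _ z2 _]]]] := T_nbrs He irr dx x2.
rewrite leqNgt; apply/negP => /card_gt1P[y [w []]]; rewrite !inE.
move=> /and4P[xy /eqP dy /eqP y2 _] /and4P[xw /eqP dw /eqP w2 _] yw.
suff : 2 < ndeg e x 2 by rewrite x2.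
apply/card_gt2P; exists y, w, z; rewrite !inE xy xw xz dy dw dz eqxx; split=> //; split=> //.
  by apply: contraTneq z2 => <-; rewrite w2.
by apply: contraTneq z2 => ->; rewrite y2.
Qed.

(** A thread vertex continues to a vertex of [T], and no vertex of degree 3 meets two threads. *)
Let card_D : #|D| <= #|T|.
Proof.
rewrite -[#|D|]mul1n -[#|T|]mul1n; apply: (double_count e_sym) => x.
  move=> xD; have /andP[/eqP dx /ndeg_gt0P[y xy dy]] : (deg e x == 2) && (0 < ndeg e x 2).
    by move: xD; rewrite inE.
  have [w [xw wy _]] := deg2_other dx xy; apply/card_gt0P; exists w.
  rewrite in_setI inE xw /=; case/orP: (D_nbr xD xw) => //; rewrite inE => /andP[/eqP dw _].
  by rewrite (two_nbr_uniq dx xw xy dw dy) eqxx in wy.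
rewrite inE => /andP[/eqP dx _]; rewrite leqNgt; apply/negP => /card_gt1P[y [z []]].
rewrite !inE => /and3P[xy /eqP dy y2] /and3P[xz /eqP dz z2] yz.
exact: (no_two_threads He irr dx xy xz yz dy dz y2 z2).
Qed.

Let card_Z : 2 * #|Z| <= #|D|.
Proof.
have ZD : Z \subset D by apply/subsetP => x; rewrite inE => /andP[].
rewrite mul2n -addnn -(cardsID Z D) (setIidPr ZD) leq_add2l.
rewrite -[#|Z|]mul1n -[#|_ :\: _|]mul1n; apply: (double_count e_sym) => x.
  move=> xZ; have /andP[/eqP dx /ndeg_gt0P[y xy dy]] : (deg e x == 2) && (0 < ndeg e x 2).
    by have := subsetP ZD x xZ; rewrite inE.
  have yx : e y x by rewrite e_sym.
  apply/card_gt0P; exists y; rewrite in_setI in_setD [y \in nbhd e x]inE xy /=.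
  rewrite [y \in D]inE dy (ndeg_gt0 yx dx) eqxx !andbT; apply/negP => yZ.
  by have := Z_rank xZ xy dy; rewrite ltnNge ltnW // (Z_rank yZ yx dx).
rewrite in_setD => /andP[_]; rewrite inE => /andP[/eqP dx _].
apply: leq_trans (deg2_ndeg2 He irr dx); apply: subset_leq_card; apply/subsetP => y.
by rewrite !inE => /andP[-> /andP[/andP[-> _] _]].
Qed.

Let I_deletable : deletable e I.
Proof.
have cI : #|I| <= #|L| + #|Q| + #|Z|.
  by rewrite /I !cardsU; lia.
rewrite /deletable K_closure /total_weight [leqRHS](bigID (fun y => y \in K)) /=.
rewrite (eq_bigr (fun y => weight (deg e y))); last first.
  move=> y yK; rewrite (_ : _ :&: K = set0) ?cards0 ?subn0 //; apply/setP => x.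
  rewrite in_setI inE in_set0; apply/negP => /andP[yx xK]; case/negP: yK.
  by apply: (K_closed xK); rewrite e_sym.
rewrite leq_add2r; apply: (@leq_trans (9 * #|L| + 5 * #|S| + 5 * #|T| + 6 * #|Q| + 6 * #|D|)).
  (* [8 Q <= 4 T] and [14 Z <= 7 D <= 6 D + T]. *)
  by move: cI card_L card_Q card_D card_Z; lia.
rewrite -!sum1_card !big_distrr /= ![\sum_(x in _) _]big_mkcond -!big_split /=.
apply: leq_sum => x _; rewrite !inE.
(* [S] and [T] are disjoint, so no weight is counted twice. *)
have ST : 0 < ndeg e x 1 -> ndeg e x 2 != 2.
  case/ndeg_gt0P => l xl dl; apply/eqP => x2.
  have [|y [z [xy _ _ dy _]]] := @ndeg_gt1P _ e x 2; first by rewrite x2.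
  by have := leaf_far xl dl xy; rewrite dy.
case: (deg e x) => [|[|[|[|d]]]] //=.
- by case: (ndeg e x 2) => [|k] //=; case: existsP.
- by case: (ndeg e x 1) ST => [_|k /(_ isT) /negPf->] //=; case: eqP.
Qed.

Lemma gadget_free : K = set0.
Proof.
have I0 : I = set0 by apply/eqP; apply/negPn/negP => /(irr I_indep)[]; exact: I_deletable.
rewrite -K_closure I0; apply/setP => x; rewrite !inE; apply/existsP => -[y].
by rewrite inE.
Qed.

Lemma no_leaf x : deg e x != 1.
Proof.
apply/negP => dx; suff : x \in K by rewrite gadget_free inE.
by rewrite !in_setU inE dx.
Qed.

Lemma no_thread x : deg e x = 2 -> ndeg e x 2 = 0.
Proof.
move=> dx; apply/eqP; rewrite -leqn0 leqNgt; apply/negP => x2.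
by suff : x \in K; [rewrite gadget_free inE | rewrite !in_setU [x \in D]inE dx x2 orbT].
Qed.

Lemma deg3_ndeg2_le1 x : deg e x = 3 -> ndeg e x 2 <= 1.
Proof.
move=> dx; rewrite -ltnS ltn_neqAle (deg3_ndeg2 He irr dx) andbT; apply/negP => x2.
by suff : x \in K; [rewrite gadget_free inE | rewrite !in_setU [x \in T]inE dx x2 !orbT].
Qed.

End Gadgets.

(** * The core *)

Definition pattern_free (V : finType) (e : rel V) (ds : seq nat) : Prop :=
  forall s : seq V, ucycle e s -> [seq deg e x | x <- s] <> ds.

Section Core.
Variables (V : finType) (e : rel V).
Hypotheses (He : sparse e) (irr : undeletable e).

Let e_sym : symmetric e. Proof. by case: He. Qed.
Let e_irr : irreflexive e. Proof. by case: He. Qed.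
Let e3 : subcubic e. Proof. by case: He. Qed.

Lemma deg23 x : deg e x = 2 \/ deg e x = 3.
Proof.
have := no_leaf He irr x; have := no_isolated He irr (x := x).
by case: (deg e x) (e3 x) => [|[|[|[|]]]] //; [left|right].
Qed.

Lemma ok_core_sound f c : embeds e f c -> ok_core c.
Proof.
move=> fc; rewrite /ok_core (admissible_sound He fc); apply/allP => i.
rewrite mem_iota => /andP[_ ni]; have le := lab_count_le He fc i 2.
have dE := embeds_deg fc ni; rewrite -dE; case: (deg23 (f i)) => di; rewrite di /=.
  by rewrite -leqn0 (leq_trans le) // (no_thread He irr).
exact: leq_trans le (deg3_ndeg2_le1 He irr di).
Qed.

Lemma deg_other2 x y z : e x y -> deg e y = 2 -> e x z -> z != y -> deg e z = 3.
Proof.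
move=> xy dy xz zy; case: (deg23 z) => // dz.
case: (deg23 x) => dx; first by have := ndeg_gt0 xy dy; rewrite (no_thread He irr).
by have := deg3_ndeg2_le1 He irr dx; rewrite leqNgt (ndeg_gt1 xz xy zy dz dy).
Qed.

Lemma no_triangle_at2 x y z w : e x w -> deg e w = 2 -> e x y -> e x z -> e y z -> 
  deg e x = 3 -> deg e y = 3 -> deg e z = 3 -> False.
Proof.
move=> xw dw xy xz yz dx dy dz.
refute_by ok_core_sound cert_core_triangle_333 x [:: x; w; y; z].
Qed.

(** If [y] had none, all neighbours of [x] and [y] except [z] would have degree 3; [no_triangle_at2]
    makes them distinct and a certificate applies. *)
Lemma ndeg2_nbr x y : deg e x = 3 -> deg e y = 3 -> e x y -> 0 < ndeg e x 2 -> 0 < ndeg e y 2.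
Proof.
move=> dx dy xy /ndeg_gt0P[z xz dz]; rewrite lt0n; apply/negP => /eqP y2.
have yx : e y x by rewrite e_sym.
have deg3 w : e y w -> deg e w = 3.
  by move=> yw; case: (deg23 w) => // dw; have := ndeg_gt0 yw dw; rewrite y2.
have [s [t [[ys yt st] sx tx _]]] := deg3_others dy yx.
have ds := deg3 _ ys; have dt := deg3 _ yt.
have zx : e z x by rewrite e_sym.
have [a [b [[xa xb ab] az bz all_x]]] := deg3_others dx xz.
have [w [xw wy wz]] : exists w, [/\ e x w, w != y & w != z].
  by have [<-|ay] := eqVneq a y; [exists b; rewrite eq_sym | exists a].
have dw := deg_other2 xz dz xw wz.
have noyw : ~ e y w by move=> yw; exact: (no_triangle_at2 xz dz xy xw yw dx dy dw).
have ws : w != s by apply: contra_notN noyw => /eqP->.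
have wt : w != t by apply: contra_notN noyw => /eqP->.
refute_by ok_core_sound cert_core_nbr x [:: x; z; y; w; s; t].
Qed.

Lemma ok_even_sound f c : embeds e f c -> ok_even c.
Proof.
move=> fc; rewrite /ok_even (ok_core_sound fc); apply/allP => i.
rewrite mem_iota => /andP[_ ni]; apply/implyP => /and3P[/eqP di fi i2].
apply/allP => j ij; have [_ nj eij] := embeds_adj He fc ij.
apply/implyP => /eqP dj; rewrite -leqn0 leqNgt; apply/negP => j2.
have eji : e (f j) (f i) by rewrite e_sym.
have := @ndeg2_nbr (f j) (f i); rewrite !(embeds_deg fc) // di dj eji.
rewrite (leq_trans j2 (lab_count_le He fc j 2)) => /(_ erefl erefl isT isT).
by rewrite -(lab_count_full He fc 2 ni fi) (eqP i2).
Qed.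

(** Otherwise [ndeg2_nbr] puts [x] in a cubic component. There, deleting the closed neighbourhood of
    [x] removes weight 20, and at most six outer edges cost 1 each, which leaves 14. *)
Lemma ndeg2_eq1 x : deg e x = 3 -> ndeg e x 2 = 1.
Proof.
move=> dx; have := deg3_ndeg2_le1 He irr dx; case x2: (ndeg e x 2) => [|[|]] // _.
have deg3 w : e x w -> deg e w = 3.
  by move=> xw; case: (deg23 w) => // dw; have := ndeg_gt0 xw dw; rewrite x2.
have /card_gt0P[a] : 0 < #|nbhd e x| by rewrite -/(deg e x) dx.
rewrite inE => xa; have [b [c [[xb xc bc] ba ca _]]] := deg3_others dx xa.
have da := deg3 _ xa; have db := deg3 _ xb; have dc := deg3 _ xc.
refute_by ok_even_sound cert_core_cubic x [:: x; a; b; c].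
Qed.

Lemma ok_pattern_sound ps f c : (forall ds, ds \in ps -> ds != [::] /\ pattern_free e ds) ->
  embeds e f c -> ok_pattern ps c.
Proof.
move=> free fc; rewrite /ok_pattern (ok_core_sound fc) /=; apply/andP; split.
  apply/allP => i; rewrite mem_iota => /andP[_ ni]; apply/implyP => /andP[/eqP di fi].
  by rewrite (lab_count_full He fc 2 ni fi) ndeg2_eq1 // (embeds_deg fc).
apply/hasPn => ds /free[ds0 dsfree]; apply/negP => /(pattern_sound He fc) /(_ ds0)[s [cs]].
exact: dsfree.
Qed.

Lemma cycle_edges (s : seq V) x0 : cycle e s ->
  all (fun p => [&& p.1 < size s, p.2 < size s & e (nth x0 s p.1) (nth x0 s p.2)])
    [seq (i, if i.+1 == size s then 0 else i.+1) | i <- iota 0 (size s)].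
Proof.
case: s => // x p /(pathP x0) cyc; apply/allP => q /mapP[i]; rewrite mem_iota => /andP[_ ni] -> /=.
rewrite add0n in ni; rewrite ni /=; have := cyc i; rewrite size_rcons => /(_ ni).
rewrite -[x :: rcons p x]/(rcons (x :: p) x) !nth_rcons /= ni.
have [->|ne] := eqVneq i (size p); first by rewrite ltnn eqxx.
have ip : i < size p by rewrite ltn_neqAle ne -ltnS.
by rewrite ip eqSS (negPf ne) ltnS ip.
Qed.

Lemma pattern_refute (ok : pred config) ts ds : ds != [::] -> (forall f c, embeds e f c -> ok c) ->
  refutes ok ts [:: (ds, [seq (i, if i.+1 == size ds then 0 else i.+1) | i <- iota 0 (size ds)])] ->
  pattern_free e ds.
Proof.
move=> ds0 ok_sound ref s /andP[cs us] ds_s.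
case: s cs us ds_s => [_ _ E|x s cs us ds_s]; first by rewrite -E in ds0.
apply: (refute He irr ok_sound ref us ds_s (x0 := x)).
by rewrite -ds_s size_map; apply: cycle_edges.
Qed.

Lemma triangle_free ds : ds \in triangles -> ds != [::] /\ pattern_free e ds.
Proof.
rewrite !inE => /orP[] /eqP->; split=> //; last first.
  exact: (pattern_refute (ds := [:: 2; 3; 3]) isT ok_core_sound cert_core_triangle_233).
move=> [|x [|y [|z [|]]]] // /andP[/= /and4P[xy yz zx _] _] [dx dy dz].
have [w xw dw] : exists2 w, e x w & deg e w = 2 by apply: ndeg_gt0P; rewrite ndeg2_eq1.
by apply: (no_triangle_at2 xw dw xy _ yz); rewrite // e_sym.
Qed.

Lemma free_rcons ps ds : (forall ds', ds' \in ps -> ds' != [::] /\ pattern_free e ds') ->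
  ds != [::] -> pattern_free e ds ->
  forall ds', ds' \in rcons ps ds -> ds' != [::] /\ pattern_free e ds'.
Proof. by move=> free ds0 dsf ds'; rewrite mem_rcons inE => /predU1P[->|/free]. Qed.

(** Each excluded cycle pattern becomes a rule for the next certificate; with all of them in force,
    a vertex of degree 3 is impossible. *)
Lemma no_vertex (x : V) : False.
Proof.
have fa : pattern_free e alpha.
  exact: (pattern_refute (ds := alpha) isT
            (fun f c => @ok_pattern_sound triangles f c triangle_free) cert_alpha).
have free1 := free_rcons triangle_free (isT : alpha != [::]) fa.
have fg : pattern_free e gamma.
  exact: (pattern_refute (ds := gamma) isT (fun f c => ok_pattern_sound free1) cert_gamma).
have free2 := free_rcons free1 (isT : gamma != [::]) fg.
have fb : pattern_free e beta.
  exact: (pattern_refute (ds := beta) isT (fun f c => ok_pattern_sound free2) cert_beta).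
have free3 := free_rcons free2 (isT : beta != [::]) fb.
(* In the absence of threads, the neighbours of a vertex of degree 2 have degree 3. *)
have [y dy] : exists y, deg e y = 3.
  case: (deg23 x) => dx; last by exists x.
  have /card_gt0P[y] : 0 < #|nbhd e x| by rewrite -/(deg e x) dx.
  rewrite inE => xy; exists y; case: (deg23 y) => // dy.
  by have := ndeg_gt0 xy dy; rewrite (no_thread He irr).
apply: (refute He irr (fun f c => ok_pattern_sound free3) cert_core_3 (s := [:: y]) (x0 := y)) => //.
by rewrite /= dy.
Qed.

End Core.

Theorem theorem1p6 (V : finType) (e : rel V)
  (e_sym : symmetric e) (e_irr : irreflexive e)
  (e_subcubic : subcubic e) (e_noC4 : ~ has_cycle e 4) :
  14 * indep_dom_num e <=
    14 * num_deg e 0 + 9 * num_deg e 1 + 6 * num_deg e 2 + 5 * num_deg e 3.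
Proof.
rewrite -total_weightE //; apply: indep_dom_num_weight; last by split=> //; apply: c4_freeP.
move=> W f Hf /card_gt0P[x _]; have [/existsP[I /and3P[indI I0 delI]]|noI] :=
  boolP [exists I : {set W}, [&& independent f I, I != set0 & deletable f I]]; first by exists I.
case: (no_vertex Hf _ x) => I indI I0 delI; case/existsP: noI; exists I.
by rewrite indI I0.
Qed.
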